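(* (1) If the sequent $\Gamma \vdash_I M : \sigma :: A$, where $I$ is a singleton, is provable in the Indexed Linear Calculus, then $\Gamma^\dagger \vdash M : \sigma^\circ :: \kappa(A)$ is provable in the quantitative intersection type system. (2) If the sequent $\Gamma \vdash M : \sigma :: \kappa$ is provable in the quantitative intersection type system, then there exist a context $\Gamma'$ of the Indexed Linear Calculus and a formula $A$ of indexed linear logic such that $\Gamma'^\dagger = \Gamma$ and $\Gamma' \vdash_{\{\star\}} M : \sigma^\bullet :: A$ is provable in the Indexed Linear Calculus.
   Context: Fix a finite set $Q$ of states. Terms are simply-typed $\lambda$-terms. Simple types: $\kappa ::= o \mid \kappa\to\kappa'$. Quantitative intersection type system. Refined pre-types $\sigma,\tau ::= q \mid \tau\to\sigma \mid \bigwedge_{j\in J}\tau_j$ ($q\in Q$, $J$ finite); $q::o$, and $(\bigwedge_{j\in J}\tau_j)\to\sigma :: \kappa\to\kappa'$ when all $\tau_j::\kappa$ and $\sigma::\kappa'$. Intersections are formal families, not quotiented by anything (not idempotent, associative or commutative). A type is linear if it is $q$ or an arrow. Sequents $x_1:\tau_1::\kappa_1,\ldots,x_n:\tau_n::\kappa_n\vdash M:\sigma::\kappa$. Rules: (Axiom) $x:q::o\vdash x:q::o$. (Left $\bigwedge$) from $\Gamma,x:\tau::\kappa\vdash M:\sigma::\kappa'$ infer $\Gamma,x:\bigwedge_{j\in\{i\}}\tau_j::\kappa\vdash M:\sigma::\kappa'$ ($i\in\mathbb{N}$, $\tau_i=\tau$). (Right $\bigwedge$) from $\Gamma_j\vdash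 M:\tau_j::\kappa$ ($j\in J$) infer $\bigwedge_{j\in J}\Gamma_j\vdash M:\bigwedge_{j\in J}\tau_j::\kappa$ (componentwise intersection of contexts). (Left $\to$) from $\Gamma_1\vdash N:\bigwedge_{j\in J}\tau_j::\kappa$ and $\Gamma_2,x:\sigma::\kappa'\vdash M:\alpha::\kappa''$, $\sigma$ linear, infer $\Gamma_1,\Gamma_2,f:(\bigwedge_{j\in J}\tau_j)\to\sigma::\kappa\to\kappa'\vdash M[x:=f\,N]:\alpha::\kappa''$. (Right $\to$) from $\Gamma,x:\bigwedge_{j\in J}\tau_j::\kappa\vdash M:\sigma::\kappa'$ infer $\Gamma\vdash\lambda x.M:(\bigwedge_{j\in J}\tau_j)\to\sigma::\kappa\to\kappa'$. (Weakening) $x\notin\Gamma$: from $\Gamma\vdash M:\sigma::\kappa'$ infer $\Gamma,x:\bigwedge_{j\in\emptyset}\tau_j::\kappa\vdash M:\sigma::\kappa'$. (Contraction) $x\notin\Gamma$: from $\Gamma,y:\bigwedge_{i\in I}\tau_i::\kappa,z:\bigwedge_{j\in J}\tau_j::\kappa\vdash M:\sigma::\kappa'$ infer $\Gamma,x:\bigwedge_{k\in I\uplus J}\tau_k::\kappa\vdash M[y,z:=x]:\sigma::\kappa'$. Indexed linear logic fragment. Linear pre-formulas $A,B ::= \bot_J \mid S\multimap A$, replicable pre-formulas $S ::= !_u A$, with $J$ countable and $u:J\to K$ a function between countable sets. Formulas are generated by: $\vdash_J \bot_J$; from $\vdash_J S$ and $\vdash_J A$ infer $\vdash_J S\multimap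 A$; from $\vdash_J A$ and $u:J\to K$ infer $\vdash_K !_u A$. Types: linear pre-types $\sigma ::= q \mid \vec\varphi\multimap\sigma$, compound pre-types $\vec\varphi ::= [\sigma_j \mid j\in J]$ ($J$ countable). Refinement of $J$-indexed families of types: if $q_j\in Q$ for all $j\in J$ then $\vdash_{j\in J} q_j :: \bot_J$; from $\vdash_{j\in J}\vec\varphi_j :: !_uA$ and $\vdash_{j\in J}\sigma_j::B$ infer $\vdash_{j\in J}\vec\varphi_j\multimap\sigma_j :: !_uA\multimap B$; from $\vdash_{j\in J}\sigma_j::A$ and $u:J\to K$ infer $\vdash_{k\in K}[\sigma_j\mid u(j)=k] :: !_uA$. For a bijection $u:J\to K$: $u^*(\bot_K)=\bot_J$, $u^*(S\multimap A)=u^*(S)\multimap u^*(A)$, $u^*(!_vA) = !_{u^{-1}\circ v}A$ (acting on types by reindexing). Restriction of a formula of domain $J$ to $K\subseteq J$: $\bot_J|_K=\bot_K$, $(S\multimap A)|_K = S|_K\multimap A|_K$, $(!_uA)|_K = !_v(A|_{u^{-1}(K)})$ where $u:I\to J$ and $v$ is $u$ restricted to $u^{-1}(K)$ (on types, a family $(\varphi_j)_{j\in J}$ restricts to $(\varphi_j)_{j\in K}$). Indexed Linear Calculus (ILC): sequents $\Gamma\vdash_J M:\sigma_j::B$ with $J$-indexed families of types. Rules: (Axiom) $q_j\in Q$: $x:q_j::\bot_J\vdash_J x:q_j::\bot_J$. (Right $\multimap$) from $\Gamma,x:\varphi_j::!_uA\vdash_J M:\sigma_j::B$ infer $\Gamma\vdash_J\lambda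 x.M:\varphi_j\multimap\sigma_j :: !_uA\multimap B$. (Left $\multimap$) from $\Gamma_1\vdash_J M:\varphi_j::!_uA$ and $\Gamma_2,x:\sigma_j::B\vdash_J N:\tau_j::C$ infer $\Gamma_1,\Gamma_2,f:\varphi_j\multimap\sigma_j::!_uA\multimap B\vdash_J N[x\leftarrow f\,M]:\tau_j::C$. (Weakening) from $\Gamma\vdash_J M:\sigma_j::B$ infer $\Gamma,x:[\,]::!_{\mathbf{0}_J}A\vdash_J M:\sigma_j::B$, $\mathbf{0}_J:\emptyset\to J$. (Contraction) with $u=[u_1,u_2]:J_1+J_2\to J$: from $\Gamma,y:\varphi_j::!_{u_1}(A|_{J_1}),z:\psi_j::!_{u_2}(A|_{J_2})\vdash_J M:\sigma_j::B$ infer $\Gamma,x:\varphi_j\uplus\psi_j::!_uA\vdash_J M[y,z\leftarrow x]:\sigma_j::B$. (Dereliction) $u:J\to K$ bijective: from $u^*\Gamma,x:\sigma_j::A\vdash_J M:\tau_{u(j)}::u^*B$ infer $\Gamma,x:\sigma_{u^{-1}(k)}::!_uA\vdash_K M:\tau_k::u^*B$. (Promotion) $v:J\to L$: from $\ldots,x_k:[\sigma_{i_k}\mid i_k\in I_k,u_k(i_k)=j]::!_{u_k}A_k,\ldots\vdash_J M:\tau_j::B$ infer $\ldots,x_k:[\sigma_{i_k}\mid i_k\in I_k,v(u_k(i_k))=l]::!_{v\circ u_k}A_k,\ldots\vdash_L M:[\tau_j\mid v(j)=l]::!_vB$. Translations: for a quantitative type, $q^\bullet=q$, $(\sigma\to\tau)^\bullet=\sigma^\bullet\multimap\tau^\bullet$,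 $(\bigwedge_{i\in I}\sigma_i)^\bullet=[\sigma_i^\bullet\mid i\in I]$ (as a $\{\star\}$-indexed type); $\sigma\mapsto\sigma^\circ$ is the inverse translation on $\{\star\}$-indexed types. For formulas: $\kappa(!_uA)=\kappa(A)$, $\kappa(S\multimap A)=\kappa(S)\to\kappa(A)$, $\kappa(\bot_J)=o$. For an ILC context $\Gamma = x_1:\sigma_1::A_1,\ldots,x_n:\sigma_n::A_n$, $\Gamma^\dagger = x_1:\sigma_1^\circ::\kappa(A_1),\ldots,x_n:\sigma_n^\circ::\kappa(A_n)$.
   Formalization: In (Right ⋀), M must be simply typed in the same cut-free calculus (matters only for J empty, where otherwise (λx.x)y : ⋀_∅ refutes (2)); (1) is stated when σ° and Γ† exist, i.e. compound types are finite; index sets of fibres and unions are taken up to bijection. *)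

(* Defs.v *)
From Stdlib Require Import List Permutation Program.Equality.
From Stdlib Require FunctionalExtensionality ProofIrrelevance Eqdep.
From HB Require Import structures.
From mathcomp Require Import all_boot.

Set Implicit Arguments.
Unset Strict Implicit.
Unset Printing Implicit Defensive.

(* Two families are the same up to a bijective renaming of their indices.
   Types carry concrete index sets and are not quotiented.  The index sets of
   [sigma_j | u(j) = k], of a disjoint union, or of an intersection of
   intersections are canonical only up to such a renaming, so the rules below
   name those families through this relation.  The members themselves are
   compared by Leibniz equality. *)
Definition same_family (T H K : Type) (f : H -> T) (g : K -> T) : Prop :=
  exists2 e : H -> K, bijective e & f =1 g \o e.

Definition finite_index (J : countType) : Prop :=
  exists s : seq J, forall j, j \in s.

Inductive kind : Type :=
  | KBase
  | KArr of kind & kind.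

(* Locally nameless lambda-terms: bound variables are de Bruijn indices, free
   variables are names, so Leibniz equality is alpha-equivalence and replacing a
   free variable by a locally closed term (the only kind occurring in derivable
   sequents) never captures. *)
Inductive term : Type :=
  | TBound of nat
  | TFree of nat
  | TApp of term & term
  | TAbs of term.

Fixpoint close (x k : nat) (M : term) : term :=
  match M with
  | TBound n => TBound n
  | TFree y => if y == x then TBound k else TFree y
  | TApp M1 M2 => TApp (close x k M1) (close x k M2)
  | TAbs M1 => TAbs (close x k.+1 M1)
  end.

Definition lam (x : nat) (M : term) : term := TAbs (close x 0 M).

Fixpoint subst (x : nat) (P M : term) : term :=
  match M with
  | TBound n => TBound n
  | TFree y => if y == x then P else TFree y
  | TApp M1 M2 => TApp (subst x P M1) (subst x P M2)
  | TAbs M1 => TAbs (subst x P M1)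
  end.

(* M[y,z := x] *)
Definition merge_vars (y z x : nat) (M : term) : term :=
  subst y (TFree x) (subst z (TFree x) M).

(* The simply-typed sequents x1 : k1, ..., xn : kn |- M : k which the sequents
   of the two calculi refine: the rules are those of either calculus with the
   types erased.  There is no cut and axioms are at the base kind, so only
   beta-normal, eta-long terms are derivable. *)
Inductive simply_typed : seq (nat * kind) -> term -> kind -> Prop :=
  | simple_ax x : simply_typed [:: (x, KBase)] (TFree x) KBase
  | simple_exchange D D' M k :
      Permutation D D' -> simply_typed D M k -> simply_typed D' M k
  | simple_left D1 D2 f x N M k k' k'' :
      uniq (f :: map fst (D1 ++ D2)) ->
      simply_typed D1 N k -> simply_typed ((x, k') :: D2) M k'' ->
      simply_typed ((f, KArr k k') :: D1 ++ D2)
             (subst x (TApp (TFree f) N) M) k''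
  | simple_right D x M k k' :
      simply_typed ((x, k) :: D) M k' -> simply_typed D (lam x M) (KArr k k')
  | simple_weak D x M k k' :
      x \notin map fst D -> simply_typed D M k' -> simply_typed ((x, k) :: D) M k'
  | simple_contr D x y z M k k' :
      x \notin map fst D ->
      simply_typed [:: (y, k), (z, k) & D] M k' ->
      simply_typed ((x, k) :: D) (merge_vars y z x M) k'.

(* Lin: linear types and formulas.  Rep: intersections, compound types and
   replicable formulas. *)
Inductive flavor : Type := Lin | Rep.

(* The flavor index builds in what kinding imposes on pre-types: the source of an
   arrow is an intersection, its target is linear, and the members of an
   intersection are linear. *)
Inductive qtype (Q : finType) : flavor -> Type :=
  | QState of Q : qtype Q Lin
  | QArr of qtype Q Rep & qtype Q Lin : qtype Q Lin
  | QInter (J : countType) of finite_index J & (J -> qtype Q Lin) : qtype Q Rep.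

(* A linear type counts as a one-member family. *)
Definition qidx (Q : finType) s (t : qtype Q s) : countType :=
  if t is QInter J _ _ then J else unit.

Definition qmem (Q : finType) s (t : qtype Q s) : qidx t -> qtype Q Lin :=
  match t return qidx t -> qtype Q Lin with
  | QState q => fun=> QState q
  | QArr phi sigma => fun=> QArr phi sigma
  | QInter _ _ tau => tau
  end.

Inductive kinding (Q : finType) : forall s, qtype Q s -> kind -> Prop :=
  | kinding_state (q : Q) : kinding (QState q) KBase
  | kinding_arr phi (sigma : qtype Q Lin) k k' :
      kinding phi k -> kinding sigma k' -> kinding (QArr phi sigma) (KArr k k')
  | kinding_inter J (fJ : finite_index J) (tau : J -> qtype Q Lin) k :
      (forall j, kinding (tau j) k) -> kinding (QInter fJ tau) k.

Record qentry (Q : finType) : Type := QEntry {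
  qname : nat;
  qflavor : flavor;
  qty : qtype Q qflavor;
  qkind : kind
}.

Definition qctx (Q : finType) : Type := seq (qentry Q).

Definition qnames (Q : finType) (G : qctx Q) : seq nat := map (@qname Q) G.

Definition qerase (Q : finType) (G : qctx Q) : seq (nat * kind) :=
  [seq (qname e, qkind e) | e <- G].

(* Componentwise intersection of contexts.  Intersections of intersections are
   flattened into the disjoint union of the families: nested intersections have
   no kind. *)
Inductive qctx_inter (Q : finType) (J : countType) :
    (J -> qctx Q) -> qctx Q -> Prop :=
  | qctx_inter_nil : qctx_inter (fun=> [::]) [::]
  | qctx_inter_cons Gs G x k s (tau : J -> qtype Q s) (phi : qtype Q Rep) :
      same_family (@qmem Q Rep phi)
        (fun p : {j : J & qidx (tau j)} => @qmem Q s (tau (tag p)) (tagged p)) ->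
      qctx_inter Gs G ->
      qctx_inter (fun j => QEntry x (tau j) k :: Gs j) (QEntry x phi k :: G).

(* In q_right_inter the simple typing premise says that the conclusion refines a
   simply-typed sequent.  It follows from the other premises unless J is
   empty, when there is nothing else to constrain M. *)
Inductive quant (Q : finType) :
    qctx Q -> term -> forall s, qtype Q s -> kind -> Prop :=
  | q_ax x (q : Q) :
      quant [:: QEntry x (QState q) KBase] (TFree x) (QState q) KBase
  | q_exchange G G' M s (sigma : qtype Q s) k :
      Permutation G G' -> quant G M sigma k -> quant G' M sigma k
  | q_left_inter G x (tau : qtype Q Lin) (phi : qtype Q Rep) k M
      s (sigma : qtype Q s) k' :
      same_family (@qmem Q Rep phi) (fun _ : unit => tau) ->
      quant (QEntry x tau k :: G) M sigma k' ->
      quant (QEntry x phi k :: G) M sigma k'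
  | q_right_inter (J : countType) (fJ : finite_index J) (Gs : J -> qctx Q) G M
      (tau : J -> qtype Q Lin) k :
      qctx_inter Gs G -> simply_typed (qerase G) M k ->
      (forall j, quant (Gs j) M (tau j) k) ->
      quant G M (QInter fJ tau) k
  | q_left_arr G1 G2 f x N M (phi : qtype Q Rep) (sigma : qtype Q Lin)
      s (alpha : qtype Q s) k k' k'' :
      uniq (f :: qnames (G1 ++ G2)) ->
      quant G1 N phi k -> quant (QEntry x sigma k' :: G2) M alpha k'' ->
      quant (QEntry f (QArr phi sigma) (KArr k k') :: G1 ++ G2)
            (subst x (TApp (TFree f) N) M) alpha k''
  | q_right_arr G x M (phi : qtype Q Rep) (sigma : qtype Q Lin) k k' :
      quant (QEntry x phi k :: G) M sigma k' ->
      quant G (lam x M) (QArr phi sigma) (KArr k k')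
  | q_weak G (x : nat) M (phi : qtype Q Rep) s (sigma : qtype Q s) k k' :
      x \notin qnames G -> (qidx phi -> False) ->
      quant G M sigma k' -> quant (QEntry x phi k :: G) M sigma k'
  | q_contr G (x y z : nat) M (phi psi chi : qtype Q Rep) s (sigma : qtype Q s) k k' :
      x \notin qnames G ->
      same_family (@qmem Q Rep chi)
        (fun p : qidx phi + qidx psi =>
           match p with
           | inl i => @qmem Q Rep phi i
           | inr i => @qmem Q Rep psi i
           end) ->
      quant [:: QEntry y phi k, QEntry z psi k & G] M sigma k' ->
      quant (QEntry x chi k :: G) (merge_vars y z x M) sigma k'.

Lemma kinding_qmem (Q : finType) s (t : qtype Q s) k :
  kinding t k <-> (forall i, kinding (@qmem Q s t i) k).
Proof.
split.
- by case=> [q|phi sg k1 k2 h1 h2|J fJ tau k0 h] i //=; constructor.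
- case: t => [q|phi sg|J fJ tau] /= h.
  + exact: (h tt).
  + exact: (h tt).
  + by constructor.
Qed.

Lemma quant_kinded (Q : finType) (G : qctx Q) M s (t : qtype Q s) k :
  quant G M t k ->
  Forall (fun e => kinding (qty e) (qkind e)) G /\ kinding t k.
Proof.
elim=> {G M s t k}.
- by move=> x q; split; repeat constructor.
- by move=> G G' M s t k p _ [h1 h2]; split => //; apply: Permutation_Forall p h1.
- move=> G x tau phi k M s sg k' [e be he] _ [/Forall_cons_iff[h1 h2] h3]; split=> //.
  by constructor => //; apply/kinding_qmem => i; rewrite he.
- move=> J fJ Gs G M tau k hG _ _ IH; split; last by constructor=> j; case: (IH j).
  have {IH} : forall j, Forall (fun e => kinding (qty e) (qkind e)) (Gs j).
    by move=> j; case: (IH j).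
  elim: hG => {G Gs} // Gs G x k0 s0 tau0 phi [e be he] _ IH h; constructor.
    apply/kinding_qmem => i; rewrite he /=.
    have /Forall_cons_iff[h1 _] := h (tag (e i)); by move/kinding_qmem: h1.
  by apply: IH => j; have /Forall_cons_iff[] := h j.
- move=> G1 G2 f x N M phi sg s al k k' k'' _ _ [h1 h2] _ [/Forall_cons_iff[h3 h4] h5]; split=> //.
  constructor; first by constructor.
  by apply/Forall_app.
- by move=> G x M phi sg k k' _ [/Forall_cons_iff[h1 h2] h3]; split => //; constructor.
- move=> G x M phi s sg k k' _ h _ [h1 h2]; split=> //; constructor=> //.
  by apply/kinding_qmem => i; case: (h i).
- move=> G x y z M phi psi chi s sg k k' _ [e be he] _ [/Forall_cons_iff[h1 /Forall_cons_iff[h2 h3]] h4].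
  split=> //; constructor=> //; apply/kinding_qmem => i; rewrite he /=.
  by case: (e i) => j; [move/kinding_qmem: h1|move/kinding_qmem: h2]; apply.
Qed.

(* formula J s: the formulas A with |-_J A. *)
Inductive formula (J : countType) : flavor -> Type :=
  | Bot : formula J Lin
  | Lolli of formula J Rep & formula J Lin : formula J Lin
  | Bang (I : countType) (u : I -> J) of formula I Lin : formula J Rep.

Arguments Bot {J}.
Arguments Bang {J I} u A.

Fixpoint kind_of (J : countType) s (A : formula J s) : kind :=
  match A with
  | Bot => KBase
  | Lolli R B => KArr (kind_of R) (kind_of B)
  | Bang _ _ B => kind_of B
  end.

(* u^* A for a bijection u : J -> K, given through its inverse v : K -> J. *)
Fixpoint reindex_formula (J K : countType) (v : K -> J) s (A : formula K s) :
    formula J s :=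
  match A in formula _ s return formula J s with
  | Bot => Bot
  | Lolli R B => Lolli (reindex_formula v R) (reindex_formula v B)
  | Bang _ w B => Bang (v \o w) B
  end.

(* The restriction of u : I -> J to u^-1(P). *)
Definition corestrict (I J : countType) (u : I -> J) (P : pred J)
    (i : {i : I | P (u i)}) : {j : J | P j} :=
  exist _ (u (sval i)) (svalP i).

Fixpoint restrict_formula (J : countType) (P : pred J) s (A : formula J s) :
    formula {j : J | P j} s :=
  match A in formula _ s return formula {j : J | P j} s with
  | Bot => Bot
  | Lolli R B => Lolli (restrict_formula P R) (restrict_formula P B)
  | Bang _ u B => Bang (@corestrict _ _ u P)
                       (restrict_formula (fun i => P (u i)) B)
  end.

Inductive itype (Q : finType) : flavor -> Type :=
  | IState of Q : itype Q Lin
  | ILolli of itype Q Rep & itype Q Lin : itype Q Lin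
  | IFam (J : countType) of (J -> itype Q Lin) : itype Q Rep.

Definition iidx (Q : finType) s (t : itype Q s) : countType :=
  if t is IFam J _ then J else unit.

Definition imem (Q : finType) s (t : itype Q s) : iidx t -> itype Q Lin :=
  match t return iidx t -> itype Q Lin with
  | IState q => fun=> IState q
  | ILolli phi sigma => fun=> ILolli phi sigma
  | IFam _ tau => tau
  end.

(* phi k = [sigma_i | u(i) = k] for all k *)
Definition is_bracket (Q : finType) (I K : countType) (u : I -> K)
    (sigma : I -> itype Q Lin) (phi : K -> itype Q Rep) : Prop :=
  forall k, same_family (@imem Q Rep (phi k))
                        (fun i : {i : I | u i == k} => sigma (sval i)).

Inductive refines (Q : finType) :
    forall (J : countType) s, formula J s -> (J -> itype Q s) -> Prop :=
  | refines_bot (J : countType) (q : J -> Q) :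
      refines (@Bot J) (fun j => IState (q j))
  | refines_lolli (J : countType) R B (phi : J -> itype Q Rep)
      (sigma : J -> itype Q Lin) :
      refines R phi -> refines B sigma ->
      refines (Lolli R B) (fun j => ILolli (phi j) (sigma j))
  | refines_bang (I K : countType) (u : I -> K) (A : formula I Lin)
      (sigma : I -> itype Q Lin) (phi : K -> itype Q Rep) :
      refines A sigma -> is_bracket u sigma phi -> refines (Bang u A) phi.

Record ientry (Q : finType) (J : countType) : Type := IEntry {
  iname : nat;
  iflavor : flavor;
  ity : J -> itype Q iflavor;
  iform : formula J iflavor
}.

Definition ictx (Q : finType) (J : countType) : Type := seq (ientry Q J).

Definition inames (Q : finType) (J : countType) (G : ictx Q J) : seq nat :=
  map (@iname Q J) G.

(* u^* on contexts, v being the inverse of u *)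
Definition ireindex (Q : finType) (J K : countType) (u : J -> K) (v : K -> J)
    (G : ictx Q K) : ictx Q J :=
  [seq IEntry (iname e) (fun j => ity e (u j)) (reindex_formula v (iform e))
  | e <- G].

Inductive ientry_promote (Q : finType) (J L : countType) (v : J -> L) :
    ientry Q J -> ientry Q L -> Prop :=
  | IEntryPromote x (I : countType) (u : I -> J) (A : formula I Lin)
      (sigma : I -> itype Q Lin) (phi : J -> itype Q Rep)
      (psi : L -> itype Q Rep) :
      refines A sigma ->
      is_bracket u sigma phi -> is_bracket (v \o u) sigma psi ->
      ientry_promote v (IEntry x phi (Bang u A))
                       (IEntry x psi (Bang (v \o u) A)).

(* Families are required to refine their formulas only where a rule introduces
   them; the rules preserve this for the whole sequent.
   In i_weak, E plays the role of the empty set.  In i_contr, J1 and J2 are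
   the two parts {i | P i} and {i | ~~ P i} of the domain I = J1 + J2 of A. *)
Inductive ilc (Q : finType) : forall J : countType,
    ictx Q J -> term -> forall s, (J -> itype Q s) -> formula J s -> Prop :=
  | i_ax (J : countType) x (q : J -> Q) :
      ilc [:: IEntry x (fun j => IState (q j)) Bot] (TFree x)
          (fun j => IState (q j)) Bot
  | i_exchange (J : countType) (G G' : ictx Q J) M s (sigma : J -> itype Q s) B :
      Permutation G G' -> ilc G M sigma B -> ilc G' M sigma B
  | i_right (J : countType) (G : ictx Q J) x M (phi : J -> itype Q Rep)
      (sigma : J -> itype Q Lin) R B :
      ilc (IEntry x phi R :: G) M sigma B ->
      ilc G (lam x M) (fun j => ILolli (phi j) (sigma j)) (Lolli R B)
  | i_left (J : countType) (G1 G2 : ictx Q J) f x M N (phi : J -> itype Q Rep)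
      (sigma : J -> itype Q Lin) s (tau : J -> itype Q s) R B C :
      uniq (f :: inames (G1 ++ G2)) ->
      ilc G1 M phi R -> ilc (IEntry x sigma B :: G2) N tau C ->
      ilc (IEntry f (fun j => ILolli (phi j) (sigma j)) (Lolli R B) :: G1 ++ G2)
          (subst x (TApp (TFree f) M) N) tau C
  | i_weak (J E : countType) (u : E -> J) (A : formula E Lin) (G : ictx Q J)
      (x : nat) M (phi : J -> itype Q Rep) s (sigma : J -> itype Q s) B :
      x \notin inames G -> (E -> False) -> (forall j, iidx (phi j) -> False) ->
      ilc G M sigma B -> ilc (IEntry x phi (Bang u A) :: G) M sigma B
  | i_contr (I J : countType) (u : I -> J) (A : formula I Lin) (P : pred I)
      (G : ictx Q J) (x y z : nat) M (phi psi chi : J -> itype Q Rep)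
      s (sigma : J -> itype Q s) B :
      x \notin inames G ->
      (forall j, same_family (@imem Q Rep (chi j))
         (fun p : iidx (phi j) + iidx (psi j) =>
            match p with
            | inl i => @imem Q Rep (phi j) i
            | inr i => @imem Q Rep (psi j) i
            end)) ->
      ilc [:: IEntry y phi (Bang (fun i : {i | P i} => u (sval i))
                                 (restrict_formula P A)),
              IEntry z psi (Bang (fun i : {i | ~~ P i} => u (sval i))
                                 (restrict_formula (fun i => ~~ P i) A))
            & G] M sigma B ->
      ilc (IEntry x chi (Bang u A) :: G) (merge_vars y z x M) sigma B
  | i_der (J K : countType) (u : J -> K) (v : K -> J) (A : formula J Lin)
      (G : ictx Q K) x M (sigma : J -> itype Q Lin) (phi : K -> itype Q Rep)
      s (tau : K -> itype Q s) B :
      cancel u v -> cancel v u -> is_bracket u sigma phi ->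
      ilc (IEntry x sigma A :: ireindex u v G) M (fun j => tau (u j))
          (reindex_formula v B) ->
      ilc (IEntry x phi (Bang u A) :: G) M tau B
  | i_prom (J L : countType) (v : J -> L) (G : ictx Q J) (G' : ictx Q L) M
      (tau : J -> itype Q Lin) (psi : L -> itype Q Rep) B :
      Forall2 (ientry_promote v) G G' -> is_bracket v tau psi ->
      ilc G M tau B -> ilc G' M psi (Bang v B).

Fixpoint bullet (Q : finType) s (t : qtype Q s) : itype Q s :=
  match t with
  | QState q => IState q
  | QArr phi sigma => ILolli (bullet phi) (bullet sigma)
  | QInter _ _ tau => IFam (fun j => bullet (tau j))
  end.

Lemma bullet_inj (Q : finType) s : injective (@bullet Q s).
Proof.
move=> t t'; move: t.
induction t' as [q|phi IHp sg IHs|J fJ tau IH] => t; dependent destruction t => //= E.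
- by injection E => ->.
- by injection E => /IHs -> /IHp ->.
- injection E => H1 H2; subst J0.
  have /= H3 := Eqdep.EqdepTheory.inj_pair2 _ _ _ _ _ H1.
  have -> : q = tau.
    by apply: FunctionalExtensionality.functional_extensionality => j; apply: IH; apply: (FunctionalExtensionality.equal_f H3 j).
  by rewrite (ProofIrrelevance.proof_irrelevance _ f fJ).
Qed.

(* circ sigma tau: the inverse translation sigma^o is defined and equal to tau.
   It is undefined on types containing an infinite compound type. *)
Definition circ (Q : finType) s (sigma : itype Q s) (tau : qtype Q s) : Prop :=
  bullet tau = sigma.

(* For a singleton J = {i}, G^dagger is defined and equal to G'. *)
Inductive dagger_entry (Q : finType) (J : countType) (i : J) :
    ientry Q J -> qentry Q -> Prop :=
  | DaggerEntry x s (sigma : J -> itype Q s) (A : formula J s)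
      (tau : qtype Q s) :
      circ (sigma i) tau ->
      dagger_entry i (IEntry x sigma A) (QEntry x tau (kind_of A)).

Definition dagger (Q : finType) (J : countType) (i : J) (G : ictx Q J)
    (G' : qctx Q) : Prop :=
  Forall2 (dagger_entry i) G G'.

(* Main.v *)
(* An ILC derivation over J is, pointwise, a J-family of intersection typings of
   one term; the difficulty of the converse is that the members of such a family
   may apply the structural and left rules in different orders.

   From ILC to intersection types one reads off, by induction on the derivation,
   the sequent at each index j; promotion becomes the right rule for
   intersections over the fiber of v.

   In the other direction, intersection derivations are first turned into a
   typing driven by the shape of the eta-long beta-normal term, in which a context
   is a set of resources consumed exactly once each.  A family of such typings of
   one term can then be inverted simultaneously, and yields an ILC derivation by
   induction on the size of the term: the head of a spine is contracted out of its
   variable and derelicted, and every argument is promoted from the family of all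
   its copies.  The formulas in a contraction of ILC are restrictions of a given
   one, so the construction must succeed for every choice of formulas refined by
   the given types.  Right intersection is the only rule that needs the family
   theorem; the others are simulated one by one over a singleton index. *)
From Stdlib Require Import List Permutation Program.Equality.
From Stdlib Require Import FunctionalExtensionality ClassicalChoice ClassicalEpsilon.
Require Import Defs.
From HB Require Import structures.
From mathcomp Require Import all_boot.

Set Implicit Arguments.
Unset Strict Implicit.
Unset Printing Implicit Defensive.

(** * Renaming, substitution and simple types *)

(** A family over [J] of typings of one term is encoded by a single function from the resources of
    its context to [J]: the fiber over [j] is what the typing at [j] consumes, and the restriction
    of the function to an entry is the [u] of its formula [!_u A]. The rules become operations on
    functions: contraction cuts the set of resources in two, promotion composes functions,
    dereliction asks for a bijection. An index set may be empty, since an argument of a spine may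
    have no copy. Resource typings then say nothing about the term, and a simple typing of its
    eta-long form must supply the shape; this is why simple typing is carried along. Splitting a
    context yields two halves with the same names, which a left rule does not accept; hence the
    renamings around each application. *)

Inductive var : Type := Bd of nat | Fr of nat.

Definition tvar (v : var) : term :=
  match v with Bd n => TBound n | Fr x => TFree x end.

Definition shift (v : var) : var :=
  match v with Bd n => Bd n.+1 | Fr x => Fr x end.

Definition up (r : var -> var) (v : var) : var :=
  match v with
  | Bd 0 => Bd 0
  | Bd n.+1 => shift (r (Bd n))
  | Fr x => shift (r (Fr x))
  end.

(** Renaming, closing and opening are all actions of maps on [var], so this one operation replaces
    three families of commutation lemmas. *)
Fixpoint rn (r : var -> var) (M : term) : term :=
  match M with
  | TBound n => tvar (r (Bd n))
  | TFree x => tvar (r (Fr x))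
  | TApp M1 M2 => TApp (rn r M1) (rn r M2)
  | TAbs M1 => TAbs (rn (up r) M1)
  end.

Lemma up_shift r v : up r (shift v) = shift (r v).
Proof. by case: v. Qed.

Lemma rn_tvar r v : rn r (tvar v) = tvar (r v).
Proof. by case: v. Qed.

Lemma up_comp r r' : up (r \o r') = up r \o up r'.
Proof.
apply: functional_extensionality => -[[|n]|x] //=; by rewrite up_shift.
Qed.

Lemma rn_comp r r' M : rn r (rn r' M) = rn (r \o r') M.
Proof.
elim: M r r' => [n|x|M1 IH1 M2 IH2|M IH] r r' /=.
- by rewrite rn_tvar.
- by rewrite rn_tvar.
- by rewrite IH1 IH2.
- by rewrite IH up_comp.
Qed.

Definition close_var (x k : nat) (v : var) : var :=
  if v is Fr y then if y == x then Bd k else v else v.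

Definition open_var (x k : nat) (v : var) : var :=
  if v is Bd n then if n == k then Fr x else v else v.

Definition ren (r : nat -> nat) (v : var) : var :=
  match v with Bd n => Bd n | Fr x => Fr (r x) end.

Lemma close_rn x k M : close x k M = rn (close_var x k) M.
Proof.
elim: M k => [n|y|M1 IH1 M2 IH2|M IH] k //=.
- by case: eqP.
- by rewrite IH1 IH2.
- rewrite IH; congr (TAbs (rn _ M)); apply: functional_extensionality.
  by case=> [[|n]|y] //=; case: eqP.
Qed.

Lemma up_ren r : up (ren r) = ren r.
Proof. by apply: functional_extensionality => -[[|n]|x]. Qed.

Lemma subst_rn x y M : subst y (TFree x) M = rn (ren (fun n => if n == y then x else n)) M.
Proof.
elim: M => [n|z|M1 IH1 M2 IH2|M IH] //=.
- by case: eqP.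
- by rewrite IH1 IH2.
- by rewrite IH up_ren.
Qed.

Lemma merge_rn y z x M :
  merge_vars y z x M = rn (ren (fun n => if (n == y) || (n == z) then x else n)) M.
Proof.
rewrite /merge_vars !subst_rn rn_comp; congr (rn _ M).
apply: functional_extensionality => -[n|n] //=.
by congr Fr; case: (n =P z) => [->|nz]; rewrite ?orbT ?orbF; case: eqP.
Qed.

Fixpoint fn (M : term) : seq nat :=
  match M with
  | TBound _ => [::]
  | TFree x => [:: x]
  | TApp M1 M2 => fn M1 ++ fn M2
  | TAbs M1 => fn M1
  end.

(** Presents any abstraction as a [lam] over a fresh name, the only form that the right rules
    produce. *)
Lemma close_open x k M : x \notin fn M -> close x k (rn (open_var x k) M) = M.
Proof.
elim: M k => [n|y|M1 IH1 M2 IH2|M IH] k /=.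
- by case: (n =P k) => //= ->; rewrite eqxx.
- by rewrite inE eq_sym => /negbTE ->.
- by rewrite mem_cat negb_or => /andP[h1 h2]; rewrite IH1 ?IH2.
- move=> /(IH k.+1) h; rewrite -[in RHS]h; congr (TAbs (close x _ (rn _ M))).
  by apply: functional_extensionality => -[[|n]|y] //=; rewrite eqSS; case: eqP.
Qed.

Fixpoint term_size (M : term) : nat :=
  match M with
  | TBound _ | TFree _ => 1
  | TApp M1 M2 => (term_size M1 + term_size M2).+1
  | TAbs M1 => (term_size M1).+1
  end.

Lemma term_size_rn r M : term_size (rn r M) = term_size M.
Proof.
elim: M r => [n|y|M1 IH1 M2 IH2|M IH] r /=; first by case: (r _).
- by case: (r _).
- by rewrite IH1 IH2.
- by rewrite IH.
Qed.

Definition lift_env (k : kind) (D : var -> kind -> Prop) (v : var) (k' : kind) : Prop :=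
  match v with
  | Bd 0 => k' = k
  | Bd n.+1 => D (Bd n) k'
  | Fr x => D (Fr x) k'
  end.

(* Syntax-directed simple typing of beta-normal eta-long terms; [ne] selects
   the neutral terms, which may have any kind but are not abstractions. *)
Fixpoint styp (ne : bool) (D : var -> kind -> Prop) (M : term) (k : kind) : Prop :=
  match M with
  | TBound n => (ne \/ k = KBase) /\ D (Bd n) k
  | TFree x => (ne \/ k = KBase) /\ D (Fr x) k
  | TApp t N => (ne \/ k = KBase) /\
      exists k', styp true D t (KArr k' k) /\ styp false D N k'
  | TAbs M => ne = false /\
      exists k1 k2, k = KArr k1 k2 /\ styp false (lift_env k1 D) M k2
  end.

Lemma lift_env_up k (D D' : var -> kind -> Prop) r :
  (forall v k', D v k' -> D' (r v) k') ->
  forall v k', lift_env k D v k' -> lift_env k D' (up r v) k'.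
Proof.
move=> h [[|n]|x] k' //= /h; by case: (r _).
Qed.

Lemma styp_rn ne (D D' : var -> kind -> Prop) r M k :
  (forall v k', D v k' -> D' (r v) k') -> styp ne D M k -> styp ne D' (rn r M) k.
Proof.
elim: M ne D D' r k => [n|y|M1 IH1 M2 IH2|M IH] ne D D' r k h /=.
- by case=> ? /h; case: (r _).
- by case=> ? /h; case: (r _).
- by case=> ? [k' [h1 h2]]; split=> //; exists k'; split; [apply: IH1 h1|apply: IH2 h2].
- case=> ? [k1 [k2 [? h1]]]; split=> //; exists k1, k2; split=> //.
  by apply: IH h1; apply: lift_env_up.
Qed.

(** Stands in for a free-variable argument: every variable that occurs in a typed term has a kind in
    [D]. *)
Lemma styp_rn_ext ne (D : var -> kind -> Prop) r r' M k :
  (forall v k', D v k' -> r v = r' v) -> styp ne D M k -> rn r M = rn r' M.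
Proof.
elim: M ne D r r' k => [n|y|M1 IH1 M2 IH2|M IH] ne D r r' k h /=.
- by case=> ? /h ->.
- by case=> ? /h ->.
- by case=> ? [k' [h1 h2]]; rewrite (IH1 _ _ _ _ _ h h1) (IH2 _ _ _ _ _ h h2).
- case=> ? [k1 [k2 [? h1]]]; congr TAbs; apply: IH h1 => -[[|n]|x] k' //=.
  + by move=> /h ->.
  + by move=> /h ->.
Qed.

Lemma rn_id M : rn id M = M.
Proof.
have e : up id = id by apply: functional_extensionality => -[[|n]|x].
by elim: M => [n|x|M1 IH1 M2 IH2|M IH] //=; rewrite ?e ?IH1 ?IH2 ?IH.
Qed.

Lemma styp_neutral D t : styp true D t KBase -> styp false D t KBase.
Proof. by case: t => [n|x|t N|M] //= [? h]; split=> //; right. Qed.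

Lemma subst_shift x t v :
  rn shift t = t -> subst x t (tvar (shift v)) = rn shift (subst x t (tvar v)).
Proof. by case: v => [n|y] //=; case: eqP. Qed.

(** Only neutral terms are substituted, so no redex arises. The hypothesis [rn shift t = t] says
    that [t] has no dangling index and hence does not change under binders. *)
Lemma styp_subst ne (D D' : var -> kind -> Prop) x t M k :
  rn shift t = t ->
  (forall v k', D v k' -> styp true D' (subst x t (tvar v)) k') ->
  styp ne D M k -> styp ne D' (subst x t M) k.
Proof.
move=> lt; elim: M ne D D' k => [n|y|M1 IH1 M2 IH2|M IH] ne D D' k h /=.
- by case=> ? /h [].
- case=> hk /h /=; case: eqP => [_|_ [] //].
  (* A variable in normal position has base kind, where neutral terms are normal too. *)
  by case: ne hk => // -[//|->]; apply: styp_neutral.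
- by case=> ? [k' [h1 h2]]; split=> //; exists k'; split; [apply: IH1 h1|apply: IH2 h2].
- case=> ? [k1 [k2 [? h1]]]; split=> //; exists k1, k2; split=> //.
  apply: IH h1 => v k' hv.
  have h' w : D w k' -> styp true (lift_env k1 D') (subst x t (tvar (shift w))) k'.
    by move=> /h hw; rewrite subst_shift //; apply: styp_rn hw => -[].
  by case: v hv => [[|n]|y] /=; [split; first by left|move/h'|move/h'].
Qed.

Definition list_env (D : seq (nat * kind)) (v : var) (k : kind) : Prop :=
  exists2 x, v = Fr x & In (x, k) D.

(** All variables of a named environment are free, so the term is locally closed. *)
Lemma styp_shift ne D M k : styp ne (list_env D) M k -> rn shift M = M.
Proof. by move=> h; rewrite -[RHS]rn_id; apply: styp_rn_ext h => v k' [x ->]. Qed.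

Lemma perm_map_fst (D D' : seq (nat * kind)) :
  Permutation D D' -> perm_eq (map fst D) (map fst D').
Proof.
elim=> {D D'} //.
- by move=> a D D' _ h /=; rewrite perm_cons.
- move=> a b D /=; exact: (permEl (perm_catCA [:: b.1] [:: a.1] _)).
- by move=> D1 D2 D3 _ h1 _; apply: perm_trans.
Qed.

Lemma simply_typed_uniq D M k : simply_typed D M k -> uniq (map fst D).
Proof.
elim=> {D M k} //=.
- by move=> D D' M k /perm_map_fst/perm_uniq <-.
- by move=> D x M k k' _ /andP[].
- by move=> D x M k k' -> _ ->.
- by move=> D x y z M k k' -> _ /and3P[].
Qed.

Lemma In_fst x k (D : seq (nat * kind)) : In (x, k) D -> x \in map fst D.
Proof.
elim: D => //= -[y l] D IH [[-> _]|/IH h]; rewrite inE ?eqxx //.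
by rewrite h orbT.
Qed.

(** Exchange and weakening only change the presentation or the size of the environment, contraction
    is a renaming, and the left rule substitutes the neutral term [f N]. *)
Lemma simply_typed_styp D M k : simply_typed D M k -> styp false (list_env D) M k.
Proof.
elim=> {D M k}.
- by move=> x /=; split; [right|exists x => //; left].
- move=> D D' M k p _ h; rewrite -(rn_id M); apply: styp_rn h => v k' [x -> i].
  by exists x => //; apply: Permutation_in i.
- move=> D1 D2 f x N M k k' k'' _ tN hN tM hM.
  have sN := styp_shift hN.
  apply: styp_subst hM; first by rewrite /= sN.
  move=> _ l [y -> i]; have /= := simply_typed_uniq tM => /andP[xD2 _].
  case: i => [[<- <-]|i] /=.
    rewrite eqxx /=; split; first by left.
    exists k; split; first by split; [left|exists f => //; left].
    rewrite -(rn_id N); apply: styp_rn hN => v k0 [z -> iz]; exists z => //.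
    by right; apply/in_app_iff; left.
  have -> : (y == x) = false.
    by apply/eqP => e; move: (In_fst i); rewrite e (negbTE xD2).
  by split; [left|exists y => //; right; apply/in_app_iff; right].
- move=> D x M k k' tM hM /=; split=> //; exists k, k'; split=> //.
  have /= := simply_typed_uniq tM => /andP[xD _].
  rewrite close_rn; apply: styp_rn hM => v l [y -> i] /=.
  case: i => [[<- <-]|i]; first by rewrite eqxx.
  have -> : (y == x) = false.
    by apply/eqP => e; move: (In_fst i); rewrite e (negbTE xD).
  by exists y.
- move=> D x M k k' _ _ h; rewrite -(rn_id M); apply: styp_rn h => v l [y -> i].
  by exists y => //; right.
- move=> D x y z M k k' _ tM h; rewrite merge_rn.
  have /= := simply_typed_uniq tM => /and3P[]; rewrite inE negb_or => /andP[_ yD] zD _.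
  apply: styp_rn h => v l [w -> i]; rewrite /list_env /=; eexists; first by [].
  case: i => [[<- <-]|[[<- <-]|i]]; rewrite ?eqxx ?orbT; try by left.
  have /negbTE -> : w != y by apply: contraNneq yD => <-; apply: In_fst i.
  have /negbTE -> : w != z by apply: contraNneq zD => <-; apply: In_fst i.
  by right.
Qed.

(** * Typing with resources *)

Definition splits (H C : Type) (P : H -> Prop) (PP : C -> H -> Prop) : Prop :=
  (forall h, P h <-> exists c, PP c h) /\
  (forall h c c', PP c h -> PP c' h -> c = c').

(** A bijection between two sets of resources, kept as a relation so that it restricts to blocks
    without sigma types or inverses. *)
Record linked (H H' : Type) (P : H -> Prop) (P' : H' -> Prop)
    (R : H -> H' -> Prop) : Prop := Linked {
  linked_dom : forall h, P h <-> exists h', R h h';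
  linked_cod : forall h', P' h' <-> exists h, R h h';
  linked_inj : forall h1 h2 h', R h1 h' -> R h2 h' -> h1 = h2;
  linked_fun : forall h h1 h2, R h h1 -> R h h2 -> h1 = h2
}.

Definition under_lam (Q : finType) (H K : Type) (l : H -> var * qtype Q Lin)
    (m : K -> qtype Q Lin) (h : H + K) : var * qtype Q Lin :=
  match h with
  | inl h => (shift (l h).1, (l h).2)
  | inr i => (Bd 0, m i)
  end.

(* Relevant typing without structural rules: the context is a set H of
   resources, each labelled by a variable and a linear type, of which M consumes
   exactly those in P, once each.  Being driven by the shape of M, it lets one
   invert simultaneously a whole family of typings of the same term. *)
Fixpoint uses (Q : finType) (H : Type) (l : H -> var * qtype Q Lin) (P : H -> Prop)
    (M : term) (s : qtype Q Lin) : Prop :=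
  match M with
  | TBound n => exists2 h, l h = (Bd n, s) & forall h', P h' <-> h' = h
  | TFree x => exists2 h, l h = (Fr x, s) & forall h', P h' <-> h' = h
  | TApp t N => exists (phi : qtype Q Rep) (PP : option (qidx phi) -> H -> Prop),
      [/\ splits P PP, uses l (PP None) t (QArr phi s)
        & forall p, uses l (PP (Some p)) N (@qmem Q Rep phi p)]
  | TAbs M => exists (phi : qtype Q Rep) (s' : qtype Q Lin),
      s = QArr phi s' /\
      uses (under_lam l (@qmem Q Rep phi))
        (fun h => if h is inl h then P h else True) M s'
  end.

Lemma uses_var (Q : finType) (H : Type) (l : H -> var * qtype Q Lin) P v s :
  uses l P (tvar v) s <-> exists2 h, l h = (v, s) & forall h', P h' <-> h' = h.
Proof. by case: v. Qed.

(** [Th] may send one resource to many: substitution trades a resource of [x] for all those of the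
    substituted term. Injectivity backwards keeps the blocks disjoint. *)
Lemma splits_transport (H H' C : Type) (P : H -> Prop) (PP : C -> H -> Prop)
    (Th : H -> H' -> Prop) (P' : H' -> Prop) :
  splits P PP ->
  (forall h1 h2 h', P h1 -> P h2 -> Th h1 h' -> Th h2 h' -> h1 = h2) ->
  (forall h', P' h' <-> exists2 h, P h & Th h h') ->
  splits P' (fun c h' => exists2 h, PP c h & Th h h').
Proof.
move=> [s1 s2] inj e; split=> [h'|h' c c' [h hc hh] [g gc gh]].
- rewrite e; split=> [[h /s1 [c hc] hh]|[c [h hc hh]]]; first by exists c, h.
  by exists h => //; apply/s1; exists c.
- have eg : h = g by apply: inj hh gh; apply/s1; [exists c|exists c'].
  by subst g; apply: s2 gc.
Qed.

Lemma uses_rn (Q : finType) (H H' : Type) (l : H -> var * qtype Q Lin)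
    (l' : H' -> var * qtype Q Lin) (P : H -> Prop) (P' : H' -> Prop) R r M s :
  linked P P' R ->
  (forall h h', R h h' -> l' h' = (r (l h).1, (l h).2)) ->
  uses l P M s -> uses l' P' (rn r M) s.
Proof.
elim: M H H' l l' P P' R r s => [n|x|M1 IH1 M2 IH2|M IH] H H' l l' P P' R r s lk hl.
- move=> /= [h lh hP]; have [h' hh] : exists h', R h h' by apply/(linked_dom lk)/hP.
  apply/uses_var; exists h'; first by rewrite (hl _ _ hh) lh.
  move=> g; rewrite (linked_cod lk); split=> [[k kg]|->]; last by exists h.
  have ek : k = h by apply/hP/(linked_dom lk); exists g.
  by subst k; apply: (linked_fun lk) kg hh.
- move=> /= [h lh hP]; have [h' hh] : exists h', R h h' by apply/(linked_dom lk)/hP.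
  apply/uses_var; exists h'; first by rewrite (hl _ _ hh) lh.
  move=> g; rewrite (linked_cod lk); split=> [[k kg]|->]; last by exists h.
  have ek : k = h by apply/hP/(linked_dom lk); exists g.
  by subst k; apply: (linked_fun lk) kg hh.
- move=> /= [phi [PP [hs h1 h2]]].
  (* The linking is restricted to each block of the partition. *)
  have lkc c : linked (PP c) (fun h' => exists2 h, PP c h & R h h')
                      (fun h h' => PP c h /\ R h h').
    split.
    + move=> h; split=> [hc|[h' []]//].
      have [h' hh] : exists h', R h h' by apply/(linked_dom lk)/hs.1; exists c.
      by exists h'.
    + by move=> h'; split=> [[h hc hh]|[h [hc hh]]]; exists h.
    + by move=> k1 k2 h' [_ a] [_]; apply: linked_inj lk _ _ _ a.
    + by move=> h k1 k2 [_ a] [_]; apply: linked_fun lk _ _ _ a.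
  exists phi, (fun c h' => exists2 h, PP c h & R h h'); split.
  + apply: splits_transport hs _ _.
      by move=> k1 k2 h' _ _; apply: linked_inj lk _ _ _.
    move=> h'; rewrite (linked_cod lk); split=> [[h hh]|[h _ hh]]; exists h => //.
    by apply/(linked_dom lk); exists h'.
  + by apply: IH1 (lkc _) _ h1 => h h' [_]; apply: hl.
  + by move=> p; apply: IH2 (lkc _) _ (h2 p) => h h' [_]; apply: hl.
- move=> /= [phi [s' [-> h]]]; exists phi, s'; split=> //.
  apply: (IH _ _ _ _ _ _ (fun a b => match a, b with
            | inl h, inl h' => R h h' | inr p, inr p' => p = p' | _, _ => False end)) h.
  + split.
    * case=> [g|p]; last by split=> // _; exists (inr p).
      rewrite (linked_dom lk); split=> [[g' gg]|[[g'|//] gg]]; last by exists g'.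
      by exists (inl g').
    * case=> [g'|p]; last by split=> // _; exists (inr p).
      rewrite (linked_cod lk); split=> [[g gg]|[[g|//] gg]]; last by exists g.
      by exists (inl g).
    * case=> [g1|p1] [g2|p2] [g'|p'] // a b; last by rewrite a b.
      by congr inl; apply: linked_inj lk _ _ _ a b.
    * case=> [g|p] [g1|p1] [g2|p2] // a b; last by rewrite -a b.
      by congr inl; apply: linked_fun lk _ _ _ a b.
  + case=> [g|p] [g'|p'] //=; first by move/hl => ->; rewrite up_shift.
    by move=> ->.
Qed.

Lemma uses_rel (Q : finType) (H H' : Type) (l : H -> var * qtype Q Lin)
    (l' : H' -> var * qtype Q Lin) (P : H -> Prop) (P' : H' -> Prop) R M s :
  linked P P' R -> (forall h h', R h h' -> l' h' = l h) ->
  uses l P M s -> uses l' P' M s.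
Proof.
move=> lk hl; rewrite -{2}(rn_id M); apply: uses_rn lk _ => h h' /hl ->.
by case: (l h).
Qed.

(** Each consumed resource [h] gets its own copy of the substituted term, which consumes [Th h].
    These sets are disjoint and cover [P'], so every resource is still used exactly once. *)
Lemma uses_subst (Q : finType) (H H' : Type) (l : H -> var * qtype Q Lin)
    (l' : H' -> var * qtype Q Lin) (P : H -> Prop) (P' : H' -> Prop)
    (Th : H -> H' -> Prop) x t M s :
  rn shift t = t ->
  (forall h, P h -> uses l' (Th h) (subst x t (tvar (l h).1)) (l h).2) ->
  (forall h1 h2 h', P h1 -> P h2 -> Th h1 h' -> Th h2 h' -> h1 = h2) ->
  (forall h', P' h' <-> exists2 h, P h & Th h h') ->
  uses l P M s -> uses l' P' (subst x t M) s.
Proof.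
move=> lt.
have base G G' (k : G -> var * qtype Q Lin) (k' : G' -> var * qtype Q Lin)
    (R : G -> Prop) (R' : G' -> Prop) (Sh : G -> G' -> Prop) v sg :
    (forall h, R h -> uses k' (Sh h) (subst x t (tvar (k h).1)) (k h).2) ->
    (forall h', R' h' <-> exists2 h, R h & Sh h h') ->
    uses k R (tvar v) sg -> uses k' R' (subst x t (tvar v)) sg.
  move=> hu hR /uses_var[h kh hP].
  have Rh : R h by apply/hP.
  have := hu _ Rh; rewrite kh /=; apply: (uses_rel (R := fun a b => Sh h a /\ a = b)).
  - split.
    + by move=> g; split=> [gg|[g' []]//]; exists g.
    + move=> g'; rewrite hR; split=> [[g /hP -> gg]|[g [gg <-]]].
        by exists g'.
      by exists h.
    + by move=> a b c [_ ->] [_ ->].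
    + by move=> a b c [_ <-] [_ <-].
  - by move=> a b [_ ->].
elim: M H H' l l' P P' Th s => [n|y|M1 IH1 M2 IH2|M IH] H H' l l' P P' Th s hu inj hP.
- exact: (base H H' l l' P P' Th (Bd n) s hu hP).
- exact: (base H H' l l' P P' Th (Fr y) s hu hP).
- move=> /= [phi [PP [hs h1 h2]]].
  have sub c h : PP c h -> P h by move=> hc; apply/hs.1; exists c.
  exists phi, (fun c h' => exists2 h, PP c h & Th h h'); split.
  + exact: splits_transport hs inj hP.
  + apply: (IH1 _ _ _ _ _ _ Th _ _ _ _ h1) => //.
      by move=> h /sub; apply: hu.
    by move=> a b c /sub pa /sub; apply: inj.
  + move=> p; apply: (IH2 _ _ _ _ _ _ Th _ _ _ _ (h2 p)) => //.
      by move=> h /sub; apply: hu.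
    by move=> a b c /sub pa /sub; apply: inj.
- move=> /= [phi [s' [-> h]]]; exists phi, s'; split=> //.
  apply: (IH _ _ _ _ _ _ (fun a b => match a, b with
            | inl h, inl h' => Th h h' | inr p, inr p' => p = p' | _, _ => False end)) h.
  + case=> [g|p] /= Pg; last by exists (inr p) => // -[g'|p']; split=> // [->|[->]].
    rewrite subst_shift //; apply: (uses_rn (R := fun a b => Th g a /\ b = inl a)) (hu g Pg).
    * split.
      - by move=> a; split=> [ga|[b []]//]; exists (inl a).
      - case=> [a|p]; last by split=> // -[b []].
        by split=> [ga|[b [gb [->]]]] //; exists a.
      - by move=> a b c [_ ->] [_ [->]].
      - by move=> a b c [_ ->] [_ ->].
    * by move=> a b [_ ->].
  + case=> [g1|p1] [g2|p2] [g'|p'] // P1 P2 a b; last by rewrite a b.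
    by congr inl; apply: inj a b.
  + case=> [g'|p] /=.
      rewrite hP; split=> [[g Pg gg]|[[g|//] Pg gg]]; last by exists g.
      by exists (inl g).
    by split=> // _; exists (inr p).
Qed.

(** * Resources of a context, up to bijections that preserve labels *)

Fixpoint res (E : Type) (idx : E -> Type) (s : seq E) : Type :=
  if s is e :: s' then (idx e + res idx s')%type else Empty_set.

Fixpoint lab (E L : Type) (idx : E -> Type) (m : forall e, idx e -> L) (s : seq E) :
    res idx s -> L :=
  match s return res idx s -> L with
  | [::] => fun h => match h with end
  | e :: s' => fun h => match h with inl i => m e i | inr h' => lab m h' end
  end.

Definition full (H : Type) : H -> Prop := fun=> True.

Definition matched (H H' L : Type) (l : H -> L) (l' : H' -> L) : Prop :=
  exists2 R, linked (@full H) (@full H') R & forall h h', R h h' -> l' h' = l h.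

Lemma matched_bij (H H' L : Type) (l : H -> L) (l' : H' -> L) f g :
  cancel f g -> cancel g f -> (forall h, l' (f h) = l h) -> matched l l'.
Proof.
move=> fg gf hl; exists (fun h h' => f h = h'); last by move=> h _ <-.
split.
- by move=> h; split=> // _; exists (f h).
- by move=> h; split=> // _; exists (g h).
- by move=> a b c <- /(can_inj fg).
- by move=> a b c <-.
Qed.

Lemma matched_sym (H H' L : Type) (l : H -> L) (l' : H' -> L) :
  matched l l' -> matched l' l.
Proof.
case=> R [a b c d] hl; exists (fun x y => R y x); last by move=> h h' /hl.
by split=> // *; [apply: d; eassumption|apply: c; eassumption].
Qed.

Lemma matched_fun (H H' L : Type) (l : H -> L) (l' : H' -> L) :
  matched l l' -> exists f g, [/\ cancel f g, cancel g f & forall h, l' (f h) = l h].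
Proof.
case=> R [a b c d] hl.
have f h : {h' | R h h'} by apply: constructive_indefinite_description; apply/a.
have g h' : {h | R h h'} by apply: constructive_indefinite_description; apply/b.
exists (fun h => sval (f h)), (fun h => sval (g h)); split=> h.
- by apply: c (svalP (g _)) (svalP (f h)).
- by apply: d (svalP (f _)) (svalP (g h)).
- by apply: hl; apply: svalP.
Qed.

Lemma matched_refl (H L : Type) (l : H -> L) : matched l l.
Proof. exact: (@matched_bij _ _ _ _ _ id id). Qed.

Lemma matched_trans (H H' H'' L : Type) (l : H -> L) (l' : H' -> L) (l'' : H'' -> L) :
  matched l l' -> matched l' l'' -> matched l l''.
Proof.
move=> /matched_fun[f [g [fg gf e]]] /matched_fun[f' [g' [fg' gf' e']]].
apply: (@matched_bij _ _ _ _ _ (f' \o f) (g \o g')); try exact: can_comp.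
by move=> h /=; rewrite e' e.
Qed.

Definition join (H K L : Type) (l : H -> L) (m : K -> L) (h : H + K) : L :=
  match h with inl i => l i | inr i => m i end.

Lemma matched_join (H H' K K' L : Type) (l : H -> L) (l' : H' -> L) (m : K -> L) (m' : K' -> L) :
  matched l l' -> matched m m' -> matched (join l m) (join l' m').
Proof.
move=> /matched_fun[f [g [fg gf e]]] /matched_fun[f' [g' [fg' gf' e']]].
apply: (@matched_bij _ _ _ _ _
  (fun h => match h with inl i => inl (f i) | inr i => inr (f' i) end)
  (fun h => match h with inl i => inl (g i) | inr i => inr (g' i) end)).
- by case=> h; rewrite ?fg ?fg'.
- by case=> h; rewrite ?gf ?gf'.
- by case=> h /=.
Qed.

Lemma lab_cons (E L : Type) (idx : E -> Type) (m : forall e, idx e -> L) e (s : seq E) :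
  @lab _ _ _ m (e :: s) = join (m e) (@lab _ _ _ m s).
Proof. by apply: functional_extensionality => -[]. Qed.

Lemma matched_joinA (H H' H'' L : Type) (l : H -> L) (l' : H' -> L) (l'' : H'' -> L) :
  matched (join l (join l' l'')) (join (join l l') l'').
Proof.
apply: (@matched_bij _ _ _ _ _
  (fun h => match h with inl i => inl (inl i) | inr (inl i) => inl (inr i) | inr (inr i) => inr i end)
  (fun h => match h with inl (inl i) => inl i | inl (inr i) => inr (inl i) | inr i => inr (inr i) end)).
- by case=> [|[]].
- by case=> [[]|].
- by case=> [|[]].
Qed.

Lemma matched_joinC (H H' L : Type) (l : H -> L) (l' : H' -> L) :
  matched (join l l') (join l' l).
Proof.
by apply: (@matched_bij _ _ _ _ _
  (fun h => match h with inl i => inr i | inr i => inl i end)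
  (fun h => match h with inl i => inr i | inr i => inl i end)) => -[].
Qed.

Lemma matched_perm (E L : Type) (idx : E -> Type) (m : forall e, idx e -> L) (s s' : seq E) :
  Permutation s s' -> matched (@lab _ _ _ m s) (@lab _ _ _ m s').
Proof.
elim=> {s s'}.
- exact: matched_refl.
- by move=> e s s' _ IH; rewrite !lab_cons; apply: matched_join IH; apply: matched_refl.
- move=> e f s; rewrite !lab_cons; apply: matched_trans (matched_joinA _ _ _) _.
  apply: matched_trans _ (matched_sym (matched_joinA _ _ _)).
  by apply: matched_join; [apply: matched_joinC|apply: matched_refl].
- by move=> s1 s2 s3 _ h _; apply: matched_trans.
Qed.

Lemma matched_empty (H K L : Type) (l : H -> L) (m : K -> L) :
  (H -> False) -> matched m (join l m).
Proof.
move=> e.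
exists (fun h h' => h' = inr h); last by move=> h _ ->.
split.
- by move=> h; split=> // _; exists (inr h).
- by case=> [/e//|h]; split=> // _; exists h.
- by move=> a b c -> [].
- by move=> a b c -> ->.
Qed.

Lemma matched_cat (E L : Type) (idx : E -> Type) (m : forall e, idx e -> L) (s s' : seq E) :
  matched (join (@lab _ _ _ m s) (@lab _ _ _ m s')) (@lab _ _ _ m (s ++ s')).
Proof.
elim: s => [|e s IH]; first by apply/matched_sym/matched_empty => -[].
rewrite lab_cons (lab_cons m e (s ++ s')); apply: matched_trans (matched_sym (matched_joinA _ _ _)) _.
by apply: matched_join IH; apply: matched_refl.
Qed.

Lemma same_family_matched (T H K : Type) (f : H -> T) (g : K -> T) :
  same_family f g -> matched f g.
Proof. by case=> e [e' h1 h2] fg; apply: (@matched_bij _ _ _ _ _ e e') => // h; rewrite fg. Qed.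

Lemma matched_same_family (T H K : Type) (f : H -> T) (g : K -> T) :
  matched f g -> same_family f g.
Proof. by case/matched_fun=> e [e' [h1 h2 h3]]; exists e; [exists e'|move=> h /=]. Qed.

(** * Intersection derivations as resource typings *)

Lemma quant_simply_typed (Q : finType) (G : qctx Q) M s (t : qtype Q s) k :
  quant G M t k -> simply_typed (qerase G) M k.
Proof.
have fst_qerase (G' : qctx Q) : map fst (qerase G') = qnames G' by rewrite -map_comp.
elim=> {G M s t k}.
- by move=> x q; constructor.
- by move=> G G' M s t k /(Permutation_map (fun e => (qname e, qkind e))) p _ /(simple_exchange p).
- by [].
- by [].
- move=> G1 G2 f x N M phi sg s al k k' k'' u _ h1 _ h2 /=.
  rewrite /qerase map_cat; apply: simple_left h1 h2.
  by rewrite -map_cat fst_qerase.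
- by move=> G x M phi sg k k' _; apply: simple_right.
- by move=> G x M phi s sg k k' u _ _; apply: simple_weak; rewrite fst_qerase.
- by move=> G x y z M phi psi chi s sg k k' u _ _; apply: simple_contr; rewrite fst_qerase.
Qed.

Lemma quant_uniq (Q : finType) (G : qctx Q) M s (t : qtype Q s) k :
  quant G M t k -> uniq (qnames G).
Proof. by move/quant_simply_typed/simply_typed_uniq; rewrite -map_comp. Qed.

Lemma qmem_lin (Q : finType) (t : qtype Q Lin) :
  (exists i : qidx t, forall j, j = i) /\ forall i, @qmem Q Lin t i = t.
Proof. by dependent destruction t; split=> //; exists tt; case. Qed.

Definition qlab (Q : finType) (e : qentry Q) (i : qidx (qty e)) : var * qtype Q Lin :=
  (Fr (qname e), @qmem Q _ (qty e) i).

(** An intersection consumes its context block by block, one block per member; a linear type has a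
    single block. *)
Definition typed (Q : finType) (H : Type) (l : H -> var * qtype Q Lin) M s
    (t : qtype Q s) : Prop :=
  exists2 PP : qidx t -> H -> Prop,
    splits (@full H) PP & forall p, uses l (PP p) M (@qmem Q s t p).

Lemma uses_matched (Q : finType) (H H' : Type) (l : H -> var * qtype Q Lin)
    (l' : H' -> var * qtype Q Lin) r M t :
  matched (fun h => (r (l h).1, (l h).2)) l' ->
  uses l (@full H) M t -> uses l' (@full H') (rn r M) t.
Proof. by case=> R lk hl; apply: uses_rn lk _ => h h' /hl. Qed.

Lemma typed_rn (Q : finType) (H H' : Type) (l : H -> var * qtype Q Lin)
    (l' : H' -> var * qtype Q Lin) r M s (t : qtype Q s) :
  matched (fun h => (r (l h).1, (l h).2)) l' -> typed l M t -> typed l' (rn r M) t.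
Proof.
case/matched_fun=> f [g [fg gf e]] [PP [p1 p2] hu]; exists (fun p h => PP p (g h)).
  split=> [h|h]; last exact: p2.
  by split=> // _; apply/p1.
move=> p; apply: (uses_rn (R := fun h h' => PP p h /\ f h = h')) (hu p).
- split.
  + by move=> h; split=> [Ph|[h' []//]]; exists (f h).
  + move=> h'; split=> [Ph|[h [Ph <-]]]; last by rewrite fg.
    by exists (g h'); split=> //; apply: gf.
  + by move=> a b c [_ <-] [_ /(can_inj fg)].
  + by move=> a b c [_ <-] [_ <-].
- by move=> h h' [_ <-]; rewrite e.
Qed.

Lemma typed_matched (Q : finType) (H H' : Type) (l : H -> var * qtype Q Lin)
    (l' : H' -> var * qtype Q Lin) M s (t : qtype Q s) :
  matched l l' -> typed l M t -> typed l' M t.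
Proof.
move=> m; rewrite -{2}(rn_id M); apply: typed_rn.
by have -> : (fun h => (id (l h).1, (l h).2)) = l by apply: functional_extensionality => h; case: (l h).
Qed.

Lemma typed_lin (Q : finType) (H : Type) (l : H -> var * qtype Q Lin) M (t : qtype Q Lin) :
  typed l M t <-> uses l (@full H) M t.
Proof.
have [[i hi] ht] := qmem_lin t; split.
- case=> PP [h1 h2] /(_ i); rewrite ht.
  have fi h : PP i h by have /h1[j] : @full H h by []; rewrite (hi j).
  apply: (uses_rel (R := fun a b => a = b)) => [|a b ->] //.
  by split=> [a|a|a b c -> ->|a b c <- <-] //; split=> // _; exists a.
- move=> h; exists (fun _ => @full H); last by move=> p; rewrite ht.
  by split=> [a|a c c' _ _]; [split=> // _; exists i|rewrite (hi c) (hi c')].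
Qed.

Lemma matched_void (H H' L : Type) (l : H -> L) (l' : H' -> L) :
  (H -> False) -> (H' -> False) -> matched l l'.
Proof.
move=> e e'; exists (fun _ _ => True) => [|h]; last by case: (e h).
by split=> [h|h'|h|h]; [case: (e h)|case: (e' h')|case: (e h)|case: (e h)].
Qed.

Lemma qmem_lin_matched (Q : finType) (t : qtype Q Lin) :
  matched (@qmem Q Lin t) (fun _ : unit => t).
Proof. by dependent destruction t; apply: matched_refl. Qed.

(** A resource of the intersected context comes from exactly one [Gs j]; remembering this [j] is
    what later sorts resources by copy. *)
Lemma matched_inter (Q : finType) (J : countType) (Gs : J -> qctx Q) G :
  qctx_inter Gs G ->
  matched (fun p : {j : J & res (fun e => qidx (qty e)) (Gs j)} =>
             lab (@qlab Q) (tagged p)) (lab (@qlab Q) (s := G)).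
Proof.
elim=> {Gs G}.
  by apply: matched_void => [[j []]|[]].
move=> Gs G x k s tau phi /same_family_matched/matched_sym/matched_fun.
case=> f [g [fg gf e]] _ /matched_fun[f' [g' [fg' gf' e']]].
apply: (@matched_bij _ _ _ _ _
  (fun p : {j : J & (qidx (tau j) + res (fun e => qidx (qty e)) (Gs j))%type} =>
     match tagged p with
     | inl i => inl (f (existT _ (tag p) i))
     | inr h => inr (f' (existT _ (tag p) h))
     end)
  (fun h => match h with
     | inl i => existT _ (tag (g i)) (inl (tagged (g i)))
     | inr h => existT _ (tag (g' h)) (inr (tagged (g' h)))
     end)).
- by case=> j [i|h] /=; rewrite ?fg ?fg'.
- by case=> [i|h] /=; [rewrite -{3}(gf i); case: (g i)|rewrite -{3}(gf' h); case: (g' h)].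
- case=> j [i|h] /=; last by rewrite e'.
  by rewrite /qlab /= (e (existT _ j i)).
Qed.

Lemma matched_map (H K L L' : Type) (l : H -> L) (m : K -> L)
    (l' : H -> L') (m' : K -> L') (r : L -> L') :
  (forall h, l' h = r (l h)) -> (forall h, m' h = r (m h)) -> matched l m -> matched l' m'.
Proof.
move=> hl hm /matched_fun[f [g [fg gf e]]].
by apply: (@matched_bij _ _ _ _ _ f g) => // h; rewrite hl hm e.
Qed.

Lemma qlab_fresh (Q : finType) x (G : qctx Q) (h : res (fun e => qidx (qty e)) G) :
  x \notin qnames G -> exists2 y, (lab (@qlab Q) h).1 = Fr y & (y == x) = false.
Proof.
elim: G h => [[]|e G IH] [i|h] /=; rewrite inE negb_or => /andP[h1 h2].
  by exists (qname e) => //; apply/negbTE; rewrite eq_sym.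
exact: IH.
Qed.

(** Structural rules disappear: exchange, left intersection and weakening change the resources by a
    bijection, contraction is a renaming of labels, and the left arrow rule is a substitution. *)
Lemma quant_typed (Q : finType) (G : qctx Q) M s (t : qtype Q s) k :
  quant G M t k -> typed (lab (@qlab Q) (s := G)) M t.
Proof.
elim=> {G M s t k}.
- move=> x q; apply/typed_lin; exists (inl tt) => //.
  by case=> [[]|[]].
- by move=> G G' M s t k p _; apply: typed_matched; apply: matched_perm.
- move=> G x tau phi k M s sg k' /same_family_matched sf _.
  apply: typed_matched; rewrite !lab_cons; apply: matched_join; last exact: matched_refl.
  have {}sf := matched_trans (qmem_lin_matched tau) (matched_sym sf).
  exact: (matched_map (r := fun t => (Fr x, t)) _ _ sf).
- move=> J fJ Gs G M tau k hG _ _ IH.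
  case/matched_inter/matched_fun: hG => f [g [fg gf e]].
  (* The block of [j] consists of the resources that come from [Gs j]. *)
  exists (fun j h => tag (g h) = j) => [|j /=].
    by split=> [h|h j j' <-//]; split=> // _; exists (tag (g h)).
  have /typed_lin := IH j.
  apply: (uses_rel (R := fun h h' => f (existT _ j h) = h')).
  + split=> [h|h'|a b c <- /(can_inj fg) E|a b c <- <-] //.
    * by split=> // _; exists (f (existT _ j h)).
    * split=> [<-|[h <-]]; last by rewrite fg.
      by exists (tagged (g h')); rewrite -[RHS]gf; case: (g h').
    * by symmetry; apply: Eqdep.EqdepTheory.inj_pair2 E.
  + by move=> h _ <-; rewrite e.
- move=> G1 G2 f x N M phi sg s al k k' k'' u hN [PN [pn1 pn2] tN] hM tM.
  have lN := styp_shift (simply_typed_styp (quant_simply_typed hN)).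
  have /= /andP[xG2 _] := quant_uniq hM.
  pose l' := join (fun _ : unit => (Fr f, QArr phi sg))
               (join (lab (@qlab Q) (s := G1)) (lab (@qlab Q) (s := G2))).
  apply: (@typed_matched _ _ _ l').
    apply: (matched_join (l' := @qlab Q (QEntry f (QArr phi sg) (KArr k k')))
                         (m' := lab (@qlab Q) (s := G1 ++ G2))).
      exact: matched_refl.
    exact: matched_cat.
  pose l2 := join (fun _ : unit => (Fr x, sg)) (lab (@qlab Q) (s := G2)).
  have [|PM [pm1 pm2] {}tM] := typed_matched (l' := l2) _ tM.
    rewrite lab_cons; apply: matched_join; last exact: matched_refl.
    exact: (matched_map (r := fun t => (Fr x, t)) _ _ (qmem_lin_matched sg)).
  (* The resource of [x] is replaced by that of [f] together with all those of [G1], which type the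
     argument; the others are kept. *)
  pose Th (h : unit + res (fun e => qidx (qty e)) G2)
    (h' : unit + (res (fun e => qidx (qty e)) G1 + res (fun e => qidx (qty e)) G2)) :=
    match h, h' with
    | inl _, inl _ => True | inl _, inr (inl _) => True
    | inr i, inr (inr i') => i = i' | _, _ => False end.
  have ThI h1 h2 h' : Th h1 h' -> Th h2 h' -> h1 = h2.
    by case: h1 h2 h' => [[]|h1] [[]|h2] [[]|[h'|h']] //= -> ->.
  exists (fun p h' => exists2 h, PM p h & Th h h').
    apply: splits_transport (conj pm1 pm2) _ _ => [h1 h2 h' _ _|h']; first exact: ThI.
    split=> // _; case: h' => [[]|[h'|h']]; by [exists (inl tt)|exists (inr h')].
  move=> p; apply: (uses_subst (l := l2) (Th := Th)) (tM p) => //.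
  + by rewrite /= lN.
  + case=> [[]|h] _ /=; last first.
      have := qlab_fresh h xG2.
      case E : (lab _ h) => [v t] /= [y ev nyx]; rewrite ev /= nyx; apply/(uses_var _ _ (Fr y)).
      exists (inr (inr h)); first by rewrite /= E ev.
      by case=> [[]|[hx|hx]]; split=> e; move: e => /=; try discriminate; try (by []); [move=> ->|case=> ->].
    (* The block [None] is the single resource of the head [f]; the other blocks are those of the
       typing of [N]. *)
    rewrite eqxx; exists phi, (fun c h' => match c, h' with
      | None, inl _ => True | Some p, inr (inl h) => PN p h | _, _ => False end); split.
    * split.
        case=> [[]|[h|h]] /=.
        - by split=> // _; exists None.
        - by split=> // _; have /pn1[c hc] : full h by []; exists (Some c).
        - by split=> // -[[]].
      case=> [[]|[h|h]] [c|] [c'|] //=; first by move=> /pn2 h1 /h1 ->.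
    * by exists (inl tt) => //; case=> [[]|[h|h]].
    * move=> c; apply: (uses_rel (R := fun h h' => PN c h /\ h' = inr (inl h))) (tN c).
        split.
        - by move=> h; split=> [hc|[h' []//]]; exists (inr (inl h)).
        - case=> [[]|[h|h]]; split=> //; try by case=> ? [].
          by move=> hc; exists h.
          by case=> h0 [h1 [->]].
        - by move=> a b c' [_ ->] [_ []].
        - by move=> a b c' [_ ->] [_ ->].
      by move=> h h' [_ ->].
  + by move=> h1 h2 h' _ _; apply: ThI.
- move=> G x M phi sg k k' hM /typed_lin tM; apply/typed_lin; exists phi, sg; split=> //.
  have /= /andP[xG _] := quant_uniq hM.
  rewrite close_rn; suff: uses (under_lam (lab (@qlab Q) (s:=G)) (@qmem Q Rep phi)) (@full _)
      (rn (close_var x 0) M) sg.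
    apply: (uses_rel (R := fun a b => a = b)) => [|a b ->] //.
    split=> [a|a|a b c -> ->|a b c <- <-] //; first by split=> // _; exists a.
    by split=> [_|_]; [exists a|case: a].
  apply: uses_matched tM.
  apply: (@matched_bij _ _ _ _ _ (fun h => match h with inl i => inr i | inr i => inl i end)
          (fun h => match h with inl i => inr i | inr i => inl i end)); try by case.
  case=> h /=; first by rewrite eqxx.
  have [y] := qlab_fresh h xG; case: (lab _ h) => v t /= -> /= -> //.
- move=> G x M phi s sg k k' _ e _; apply: typed_matched.
  by rewrite lab_cons; apply: matched_empty.
- move=> G x y z M phi psi chi s sg k k' xG /same_family_matched sf hM.
  have /= /and3P[] := quant_uniq hM; rewrite inE negb_or => /andP[_ yG] zG _.
  rewrite merge_rn; apply: typed_rn.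
  apply: (@matched_trans _ _ _ _ _ (join
    (join (@qlab Q (QEntry x phi k)) (@qlab Q (QEntry x psi k))) (lab (@qlab Q) (s:=G)))).
    apply: matched_trans _ (matched_joinA _ _ _).
    apply: (matched_map (r := id) _ _ (matched_refl _)); first by [].
    case=> [i|[i|h]] /=; rewrite ?eqxx ?orbT //.
    have [w] := qlab_fresh h yG; have [w'] := qlab_fresh h zG.
    by case: (lab _ h) => v t /= -> /= + [<-] -> => ->.
  apply: matched_join; last exact: matched_refl.
  apply: (matched_map (r := fun t => (Fr x, t)) _ _ (matched_sym sf)) => // -[] //.
Qed.

(** * Formulas and brackets *)

Lemma rn_subst r x t M : injective r ->
  rn (ren r) (subst x t M) = subst (r x) (rn (ren r) t) (rn (ren r) M).
Proof.
move=> ri; elim: M => [n|y|M1 IH1 M2 IH2|M IH] //=.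
- by rewrite (inj_eq ri); case: eqP.
- by rewrite IH1 IH2.
- by rewrite up_ren IH.
Qed.

Lemma rn_lam r x M : injective r -> rn (ren r) (lam x M) = lam (r x) (rn (ren r) M).
Proof.
move=> ri; rewrite /lam /= up_ren !close_rn !rn_comp; congr (TAbs (rn _ M)).
apply: functional_extensionality => -[n|y] //=.
by rewrite (inj_eq ri); case: eqP.
Qed.

Definition irename (Q : finType) (J : countType) (r : nat -> nat) (G : ictx Q J) : ictx Q J :=
  [seq IEntry (r (iname e)) (@ity _ _ e) (iform e) | e <- G].

Lemma inames_irename (Q : finType) (J : countType) r (G : ictx Q J) :
  inames (irename r G) = map r (inames G).
Proof. by rewrite /inames -!map_comp. Qed.

Lemma Forall2_map2 (A A' B B' : Type) (R : A -> B -> Prop) (R' : A' -> B' -> Prop) f g l l' :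
  (forall a b, R a b -> R' (f a) (g b)) -> Forall2 R l l' -> Forall2 R' (map f l) (map g l').
Proof. by move=> h; elim=> //= a b s s' /h ? _ ?; constructor. Qed.

(** Injectivity keeps names distinct. The lemma serves to make a disjoint copy of a context before a
    left rule. *)
Lemma ilc_rename (Q : finType) (J : countType) (G : ictx Q J) M s
    (sg : J -> itype Q s) B r :
  injective r -> ilc G M sg B -> ilc (irename r G) (rn (ren r) M) sg B.
Proof.
move=> ri; elim=> {J G M s sg B}.
- by move=> J x q; constructor.
- by move=> J G G' M s sg B p _; apply: i_exchange; apply: Permutation_map.
- by move=> J G x M phi sg R B _ h; rewrite rn_lam //; apply: i_right.
- move=> J G1 G2 f x M N phi sg s tau R B C u _ h1 _ h2.
  rewrite rn_subst //= /irename map_cat; apply: i_left h1 h2.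
  by rewrite -map_cat inames_irename -map_cons map_inj_uniq.
- move=> J E u A G x M phi s sg B xG e h _; apply: i_weak => //.
  by rewrite inames_irename mem_map.
- move=> J I u A P G x y z M phi psi chi s sg B xG sf _ h.
  rewrite /merge_vars !rn_subst //=; apply: i_contr sf h.
  by rewrite inames_irename mem_map.
- move=> J K u v A G x M sg phi s tau B uv vu br _ h; apply: (i_der (G := irename r G) uv vu br).
  by move: h; rewrite /irename /= /ireindex -!map_comp.
- move=> J L v G G' M tau psi B f2 br _ h; apply: (i_prom _ br h).
  by apply: Forall2_map2 f2 => _ _ [x I u A sg phi psi' h1 h2 h3]; apply: IEntryPromote h1 h2 h3.
Qed.

(** Enumerating a fiber by an injection [e] into [I], instead of a bijection with a sigma type,
    makes brackets easy to compose and restrict. *)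
Lemma is_bracketP (Q : finType) (I K : countType) (u : I -> K) (sg : I -> itype Q Lin)
    (phi : K -> itype Q Rep) :
  is_bracket u sg phi <->
  forall k, exists e : iidx (phi k) -> I,
    [/\ injective e, forall a, u (e a) = k, forall i, u i = k -> exists a, e a = i
      & forall a, @imem Q Rep (phi k) a = sg (e a)].
Proof.
split=> h k.
- have [e [e' h1 h2] h3] := h k; exists (fun a => sval (e a)); split=> //.
  + by move=> a b /val_inj /(can_inj h1).
  + by move=> a; apply/eqP/(svalP (e a)).
  + move=> i /eqP ui; exists (e' (exist _ i ui)); by rewrite h2.
- have [e [h1 h2 h3 h4]] := h k.
  have uek a : u (e a) == k by apply/eqP.
  have [g hg] : exists g : {i | u i == k} -> iidx (phi k), forall i, e (g i) = sval i.
    apply: (choice (fun (i : {i | u i == k}) a => e a = sval i)) => i.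
    exact/h3/eqP/(svalP i).
  exists (fun a => exist _ (e a) (uek a)) => //; exists g.
    by move=> a; apply: h1; rewrite hg.
  by move=> i; apply: val_inj; rewrite /= hg.
Qed.

Definition bracket (Q : finType) (I K : countType) (u : I -> K) (sg : I -> itype Q Lin)
    (k : K) : itype Q Rep :=
  IFam (fun i : {i : I | u i == k} => sg (sval i)).

Lemma bracket_is_bracket (Q : finType) (I K : countType) (u : I -> K) (sg : I -> itype Q Lin) :
  is_bracket u sg (bracket u sg).
Proof. by move=> k; exists id => //; exists id. Qed.

Lemma bracket_restrict (Q : finType) (I K : countType) (u : I -> K) (sg : I -> itype Q Lin)
    (phi : K -> itype Q Rep) (P : pred K) :
  is_bracket u sg phi ->
  is_bracket (@corestrict _ _ u P) (fun i => sg (sval i)) (fun k => phi (sval k)).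
Proof.
move/is_bracketP=> h; apply/is_bracketP => -[k Pk] /=; have [e [h1 h2 h3 h4]] := h k.
have Pe a : P (u (e a)) by rewrite h2.
exists (fun a => exist _ (e a) (Pe a)); split=> //.
- by move=> a b [/h1].
- by move=> a; apply: val_inj => /=.
- by move=> [i Pi] [/h3[a ea]]; exists a; apply: val_inj.
Qed.

Lemma refines_restrict (Q : finType) (J : countType) s (A : formula J s)
    (sg : J -> itype Q s) (P : pred J) :
  refines A sg -> refines (restrict_formula P A) (fun j => sg (sval j)).
Proof.
move=> h; elim: h P => {J s A sg} /=.
- by move=> J q P; apply: (refines_bot (fun j : {j | P j} => q (sval j))).
- by move=> J R B phi sg _ h1 _ h2 P; apply: (refines_lolli (h1 P) (h2 P)).
- by move=> I K u A sg phi _ h br P; apply: (refines_bang (h (fun i => P (u i))) (bracket_restrict (P := P) br)).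
Qed.

Lemma bracket_reindex (Q : finType) (I J K : countType) (w : I -> K) (sg : I -> itype Q Lin)
    (phi : K -> itype Q Rep) (u : J -> K) (v : K -> J) :
  cancel u v -> cancel v u -> is_bracket w sg phi ->
  is_bracket (v \o w) sg (fun j => phi (u j)).
Proof.
move=> uv vu /is_bracketP h; apply/is_bracketP => j; have [e [h1 h2 h3 h4]] := h (u j).
exists e; split=> //; first by move=> a /=; rewrite h2 uv.
by move=> i /= hi; apply: h3; rewrite -hi vu.
Qed.

Lemma refines_reindex (Q : finType) (J K : countType) (u : J -> K) (v : K -> J) s
    (A : formula K s) (sg : K -> itype Q s) :
  cancel u v -> cancel v u -> refines A sg ->
  refines (reindex_formula v A) (fun j => sg (u j)).
Proof.
move=> uv vu h; elim: h J u v uv vu => {K s A sg} /=.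
- by move=> J q ? u v _ _; apply: (refines_bot (fun j => q (u j))).
- by move=> J R B phi sg _ h1 _ h2 ? u v uv vu; apply: (refines_lolli (h1 _ _ _ uv vu) (h2 _ _ _ uv vu)).
- by move=> I K w A sg phi hA _ br J u v uv vu; apply: (refines_bang hA (bracket_reindex uv vu br)).
Qed.

Lemma kind_of_restrict (J : countType) s (A : formula J s) P :
  kind_of (restrict_formula P A) = kind_of A.
Proof. by elim: A P => {J s} //= [J R h B h' P|J I u A h P]; rewrite ?h ?h'. Qed.

Lemma kind_of_reindex (J K : countType) (v : K -> J) s (A : formula K s) :
  kind_of (reindex_formula v A) = kind_of A.
Proof. by elim: A J v => {K s} //= [K R h B h' J v]; rewrite h h'. Qed.

(** The side condition of contraction on families is automatic for brackets: the fiber of [u] over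
    [k] is cut in two by [P]. *)
Lemma bracket_contr (Q : finType) (I K : countType) (u : I -> K) (sg : I -> itype Q Lin)
    (P : pred I) (phi psi chi : K -> itype Q Rep) :
  is_bracket u sg chi ->
  is_bracket (fun i : {i | P i} => u (sval i)) (fun i => sg (sval i)) phi ->
  is_bracket (fun i : {i | ~~ P i} => u (sval i)) (fun i => sg (sval i)) psi ->
  forall k, same_family (@imem Q Rep (chi k))
         (fun p : iidx (phi k) + iidx (psi k) =>
            match p with
            | inl i => @imem Q Rep (phi k) i
            | inr i => @imem Q Rep (psi k) i
            end).
Proof.
move=> /is_bracketP hc /is_bracketP hp /is_bracketP hq k.
have [e [e1 e2 e3 e4]] := hc k; have [f [f1 f2 f3 f4]] := hp k; have [g [g1 g2 g3 g4]] := hq k.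
apply: matched_same_family.
exists (fun a p => e a = match p with inl b => sval (f b) | inr b => sval (g b) end).
  split.
  - move=> a; split=> // _; case: (boolP (P (e a))) => Pa.
      by have [b hb] := f3 (exist _ (e a) Pa) (e2 a); exists (inl b); rewrite hb.
    by have [b hb] := g3 (exist _ (e a) Pa) (e2 a); exists (inr b); rewrite hb.
  - by case=> b; split=> // _; [have [] := e3 _ (f2 b)|have [] := e3 _ (g2 b)] => a ea; exists a.
  - by move=> a b p <- /e1.
  - move=> a [b|b] [c|c] -> E.
    + by congr inl; apply/f1/val_inj.
    + by have := svalP (f b); rewrite /= E (negbTE (svalP (g c))).
    + by have := svalP (f c); rewrite /= -E (negbTE (svalP (g b))).
    + by congr inr; apply/g1/val_inj.
by move=> a [b|b] E; rewrite e4 E ?f4 ?g4.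
Qed.

(** The match in the conclusion computes the inversion from the formula, so that no equation between
    dependent pairs has to be solved. *)
Lemma refines_inv (Q : finType) (J : countType) s (A : formula J s) (sg : J -> itype Q s) :
  refines A sg ->
  match A in formula _ s return (J -> itype Q s) -> Prop with
  | Bot => fun sg => exists q, sg = fun j => IState (q j)
  | Lolli R B => fun sg => exists phi tau,
      [/\ sg = fun j => ILolli (phi j) (tau j), refines R phi & refines B tau]
  | Bang _ u A => fun phi => exists2 sg, refines A sg & is_bracket u sg phi
  end sg.
Proof.
case=> {J s A sg} [J q|J R B phi sg h1 h2|I J u A sg phi h br].
- by exists q.
- by exists phi, sg.
- by exists sg.
Qed.

Lemma kind_base (J : countType) (A : formula J Lin) : kind_of A = KBase -> A = Bot.
Proof. by dependent destruction A. Qed.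

Lemma bang_inv (J : countType) (A : formula J Rep) :
  exists (I : countType) (u : I -> J) B, A = Bang u B.
Proof. by dependent destruction A; eauto. Qed.

Lemma kind_arr (J : countType) (A : formula J Lin) k k' :
  kind_of A = KArr k k' ->
  exists (I : countType) (u : I -> J) B C,
    [/\ A = Lolli (Bang u B) C, kind_of B = k & kind_of C = k'].
Proof.
dependent destruction A => //= -[<- <-].
by have [I [u [B ->]]] := bang_inv A1; exists I, u, B, A2.
Qed.

(** The two index sets coincide only after a case analysis on [t]; the bijection hides this
    conversion. *)
Lemma iidx_bullet (Q : finType) (t : qtype Q Rep) :
  matched (@imem Q Rep (bullet t)) (fun i => bullet (@qmem Q Rep t i)).
Proof. by dependent destruction t; apply: matched_refl. Qed.

Lemma bracket_bulletP (Q : finType) (I K : countType) (u : I -> K) (sg : I -> qtype Q Lin)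
    (phi : K -> qtype Q Rep) :
  is_bracket u (fun i => bullet (sg i)) (fun k => bullet (phi k)) <->
  forall k, exists e : qidx (phi k) -> I,
    [/\ injective e, forall a, u (e a) = k, forall i, u i = k -> exists a, e a = i
      & forall a, @qmem Q Rep (phi k) a = sg (e a)].
Proof.
rewrite is_bracketP; split=> h k.
- have [e [h1 h2 h3 h4]] := h k; have [f [g [fg gf E]]] := matched_fun (iidx_bullet (phi k)).
  exists (e \o g); split=> /=.
  + exact: inj_comp h1 (can_inj gf).
  + by [].
  + by move=> i /h3[a <-]; exists (f a); rewrite fg.
  + by move=> a; apply: bullet_inj; rewrite -h4 -E gf.
- have [e [h1 h2 h3 h4]] := h k; have [f [g [fg gf E]]] := matched_fun (iidx_bullet (phi k)).
  exists (e \o f); split=> /=.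
  + exact: inj_comp h1 (can_inj fg).
  + by [].
  + by move=> i /h3[a <-]; exists (g a); rewrite gf.
  + by move=> a; rewrite -h4 E.
Qed.

(** No member of [sg] escapes the brackets: [i] lies in the fiber over [u i], so [sg i] is a member
    of a translated intersection. *)
Lemma bracket_bullet (Q : finType) (I K : countType) (u : I -> K) (sg : I -> itype Q Lin)
    (phi : K -> qtype Q Rep) :
  is_bracket u sg (fun k => bullet (phi k)) ->
  exists sg' : I -> qtype Q Lin, sg = fun i => bullet (sg' i).
Proof.
move/is_bracketP=> h.
have [sg' e] : exists sg' : I -> qtype Q Lin, forall i, sg i = bullet (sg' i).
  apply: (choice (fun i t => sg i = bullet t)) => i.
  have [e [_ _ h3 h4]] := h (u i); have [a <-] := h3 i erefl.
  have [f [g [fg gf E]]] := matched_fun (iidx_bullet (phi (u i))).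
  by exists (@qmem Q Rep (phi (u i)) (f a)); rewrite -h4 E.
by exists sg'; apply: functional_extensionality.
Qed.

Lemma refines_bang_bullet (Q : finType) (I J : countType) (u : I -> J) (A : formula I Lin)
    (phi : J -> qtype Q Rep) :
  refines (Bang u A) (fun j => bullet (phi j)) ->
  exists2 tau : I -> qtype Q Lin, refines A (fun i => bullet (tau i)) &
    is_bracket u (fun i => bullet (tau i)) (fun j => bullet (phi j)).
Proof.
by move=> /refines_inv[sg h br]; have [tau e] := bracket_bullet br; subst sg; exists tau.
Qed.

Lemma bullet_arr (Q : finType) (t : qtype Q Lin) phi sg :
  bullet t = ILolli phi sg ->
  exists phi' sg', [/\ t = QArr phi' sg', bullet phi' = phi & bullet sg' = sg].
Proof. by dependent destruction t => //= -[<- <-]; exists t1, t2. Qed.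

Lemma bullet_state (Q : finType) (t : qtype Q Lin) q : bullet t = IState q -> t = QState q.
Proof. by dependent destruction t => //= -[<-]. Qed.

Lemma refines_lolli_bullet (Q : finType) (J : countType) (R : formula J Rep) B
    (sg : J -> qtype Q Lin) :
  refines (Lolli R B) (fun j => bullet (sg j)) ->
  exists (phi : J -> qtype Q Rep) (tau : J -> qtype Q Lin),
    [/\ sg = fun j => QArr (phi j) (tau j), refines R (fun j => bullet (phi j))
      & refines B (fun j => bullet (tau j))].
Proof.
move=> /refines_inv[phi [tau [e h1 h2]]].
have hj j : exists pt : qtype Q Rep * qtype Q Lin,
    [/\ sg j = QArr pt.1 pt.2, bullet pt.1 = phi j & bullet pt.2 = tau j].
  by have [p [t h]] := bullet_arr (equal_f e j); exists (p, t).
have [f hf] := choice _ hj.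
exists (fun j => (f j).1), (fun j => (f j).2); split.
- by apply: functional_extensionality => j; case: (hf j).
- suff -> : (fun j => bullet (f j).1) = phi by [].
  by apply: functional_extensionality => j; case: (hf j).
- suff -> : (fun j => bullet (f j).2) = tau by [].
  by apply: functional_extensionality => j; case: (hf j).
Qed.

Lemma refines_bot_bullet (Q : finType) (J : countType) (sg : J -> qtype Q Lin) :
  refines (@Bot J) (fun j => bullet (sg j)) -> exists q, sg = fun j => QState (q j).
Proof.
move=> /refines_inv[q e]; exists q; apply: functional_extensionality => j.
exact: bullet_state (equal_f e j).
Qed.

(** * Families of typings in ILC *)

(* A context entry up to the choice of the function u of its formula !_u A; the
   functions u of a whole context are then one function on its resources. *)
Record bent (Q : finType) : Type := Bent {
  bname : nat;
  bidx : countType;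
  bform : formula bidx Lin;
  bsig : bidx -> qtype Q Lin;
  brefines : refines bform (fun i => bullet (bsig i))
}.

Notation bres G := (res (fun e => Countable.sort (bidx e)) G).

Definition blab (Q : finType) (e : bent Q) (i : bidx e) : var * qtype Q Lin :=
  (Fr (bname e), bsig i).

Definition bnames (Q : finType) (G : seq (bent Q)) : seq nat := map (@bname Q) G.

Fixpoint benv (Q : finType) (G : seq (bent Q)) (v : var) (k : kind) : Prop :=
  if G is e :: G' then v = Fr (bname e) /\ k = kind_of (bform e) \/ benv G' v k
  else False.

(** [phi] may be any bracket of the family, not only the canonical one, because the context to be
    derived is prescribed. *)
Fixpoint realizes (Q : finType) (J : countType) (G : seq (bent Q)) :
    (bres G -> J) -> ictx Q J -> Prop :=
  match G return (bres G -> J) -> ictx Q J -> Prop with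
  | [::] => fun _ D => D = [::]
  | e :: G' => fun u D => exists phi D',
      [/\ D = IEntry (bname e) phi (Bang (fun i => u (inl i)) (bform e)) :: D',
          is_bracket (fun i => u (inl i)) (fun i => bullet (@bsig _ e i)) phi
        & realizes (fun h => u (inr h)) D']
  end.

Lemma realizes_names (Q : finType) (J : countType) (G : seq (bent Q)) (u : bres G -> J) D :
  realizes u D -> inames D = bnames G.
Proof.
elim: G u D => [|e G IH] u D /= => [->//|[phi [D' [-> _ /IH h]]]].
by rewrite /= h.
Qed.

Lemma realizes_ex (Q : finType) (J : countType) (G : seq (bent Q)) (u : bres G -> J) :
  exists D, realizes u D.
Proof.
elim: G u => [|e G IH] u; first by exists [::].
have [D hD] := IH (fun h => u (inr h)).
exists (IEntry (bname e) (bracket (fun i => u (inl i)) (fun i => bullet (@bsig _ e i)))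
          (Bang (fun i => u (inl i)) (bform e)) :: D).
by do 2!eexists; split; [by []|apply: bracket_is_bracket|].
Qed.

Lemma realizes_reindex (Q : finType) (J K : countType) (u : J -> K) (v : K -> J)
    (G : seq (bent Q)) (w : bres G -> K) D :
  cancel u v -> cancel v u -> realizes w D -> realizes (v \o w) (ireindex u v D).
Proof.
move=> uv vu; elim: G w D => [|e G IH] w D /= => [->//|[phi [D' [-> br h]]]].
exists (fun j => phi (u j)), (ireindex u v D'); split=> //.
  exact: bracket_reindex uv vu br.
exact: (IH (fun h => w (inr h))).
Qed.

(** When the function on resources factors through [v], the context is a conclusion of promotion
    along [v]. In the premise nothing is prescribed, and canonical brackets serve. *)
Lemma realizes_promote (Q : finType) (J L : countType) (v : J -> L)
    (G : seq (bent Q)) (u : bres G -> J) D :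
  realizes (v \o u) D ->
  exists2 D0, realizes u D0 & Forall2 (ientry_promote v) D0 D.
Proof.
elim: G u D => [|e G IH] u D /= => [->|[psi [D' [-> br /IH[D0 h1 h2]]]]].
  by exists [::] => //; constructor.
pose phi := bracket (fun i => u (inl i)) (fun i => bullet (@bsig _ e i)).
exists (IEntry (bname e) phi (Bang (fun i => u (inl i)) (bform e)) :: D0).
  by exists phi, D0; split=> //; apply: bracket_is_bracket.
constructor=> //.
exact: (IEntryPromote _ (brefines e) (bracket_is_bracket _ _) br).
Qed.

(** * Splitting the resources of a context *)

Definition brestrict (Q : finType) (e : bent Q) (P : pred (bidx e)) : bent Q :=
  Bent (bname e) (refines_restrict P (brefines e)).

(** An entry stays even when it loses all its resources, so both halves of a split have the names
    and kinds of [G]. *)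
Fixpoint bsplit (Q : finType) (G : seq (bent Q)) : (bres G -> bool) -> seq (bent Q) :=
  match G return (bres G -> bool) -> seq (bent Q) with
  | [::] => fun _ => [::]
  | e :: G' => fun P => brestrict (fun i : bidx e => P (inl i)) :: bsplit (fun h => P (inr h))
  end.

Fixpoint binj (Q : finType) (G : seq (bent Q)) :
    forall P : bres G -> bool, bres (bsplit P) -> bres G :=
  match G return forall P : bres G -> bool, bres (bsplit P) -> bres G with
  | [::] => fun P h => h
  | e :: G' => fun P h => match h with inl i => inl (sval i) | inr h' => inr (binj h') end
  end.

Lemma binjP (Q : finType) (G : seq (bent Q)) (P : bres G -> bool) (h : bres (bsplit P)) :
  P (binj h).
Proof. by elim: G P h => [|e G IH] P //= [[i]|h] //; apply: (IH (fun h => P (inr h))). Qed.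

Lemma binj_inj (Q : finType) (G : seq (bent Q)) (P : bres G -> bool) : injective (@binj Q G P).
Proof.
elim: G P => [|e G IH] P //= [i|h] [j|g] //= [].
  by move=> /val_inj ->.
by move/IH ->.
Qed.

Lemma binj_onto (Q : finType) (G : seq (bent Q)) (P : bres G -> bool) h :
  P h -> exists h', @binj Q G P h' = h.
Proof.
elim: G P h => [|e G IH] P //= [i|h] Ph; first by exists (inl (exist _ i Ph)).
by have [h' <-] := IH (fun h => P (inr h)) h Ph; exists (inr h').
Qed.

Lemma lab_binj (Q : finType) (G : seq (bent Q)) (P : bres G -> bool) (h : bres (bsplit P)) :
  lab (@blab Q) (binj h) = lab (@blab Q) h.
Proof. by elim: G P h => [|e G IH] P //= [i|h] //; apply: IH. Qed.

Lemma bnames_split (Q : finType) (G : seq (bent Q)) (P : bres G -> bool) :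
  bnames (bsplit P) = bnames G.
Proof. by elim: G P => [|e G IH] P //=; rewrite IH. Qed.

Lemma benv_split (Q : finType) (G : seq (bent Q)) (P : bres G -> bool) :
  benv (bsplit P) = benv G.
Proof. by elim: G P => [|e G IH] P //=; rewrite IH kind_of_restrict. Qed.

Lemma benv_name (Q : finType) (G : seq (bent Q)) v k :
  benv G v k -> exists2 x, v = Fr x & x \in bnames G.
Proof.
elim: G => //= e G IH [[-> _]|/IH[x -> h]]; first by exists (bname e); rewrite ?inE ?eqxx.
by exists x => //; rewrite inE h orbT.
Qed.

Lemma lab_name (Q : finType) (G : seq (bent Q)) (h : bres G) :
  exists2 x, (lab (@blab Q) h).1 = Fr x & x \in bnames G.
Proof.
elim: G h => [[]|e G IH] [i|h] /=; first by exists (bname e); rewrite ?inE ?eqxx.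
by have [x -> h'] := IH h; exists x => //; rewrite inE h' orbT.
Qed.

(** * Structural rules for whole contexts *)

Lemma iexch (Q : finType) (J : countType) (G G' : ictx Q J) M s (sg : J -> itype Q s) B :
  ilc G M sg B -> Permutation G G' -> ilc G' M sg B.
Proof. by move=> h p; apply: i_exchange p h. Qed.

(** With no resources at all, the formula of every entry has an empty domain, as weakening
    demands. *)
Lemma weaken_context (Q : finType) (J : countType) (G : seq (bent Q)) (u : bres G -> J) D D'
    M s (sg : J -> itype Q s) B :
  realizes u D -> (bres G -> False) -> uniq (bnames G ++ inames D') ->
  ilc D' M sg B -> ilc (D ++ D') M sg B.
Proof.
elim: G u D => [|e G IH] u D /= => [->//|[phi [D0 [-> br hr]]]] em /andP[hn hu] h /=.
apply: i_weak.
- by rewrite /inames map_cat -/(inames D0) (realizes_names hr).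
- by move=> i; apply: em; left.
- by move=> j a; have [f _ _] := br j; apply: em; left; exact: (sval (f a)).
- by apply: IH hr _ hu h => g; apply: em; right.
Qed.

(** The second half has its names shifted by [b], a strict bound on the names of [G], so that both
    halves fit in one context. Each contraction merges [x] and [b + x] into [x]; of the composite
    renaming [r] only the effect on shifted names and on all others is recorded. *)
Lemma contract_context (Q : finType) (J : countType) b (G : seq (bent Q)) (P : bres G -> bool)
    (u : bres G -> J) D D1 D2 D' M s (sg : J -> itype Q s) B :
  realizes u D ->
  realizes (fun h : bres (bsplit P) => u (binj h)) D1 ->
  realizes (fun h : bres (bsplit (fun h => ~~ P h)) => u (binj h)) D2 ->
  uniq (bnames G) -> (forall x, x \in bnames G -> x < b) ->
  (forall x, x \in bnames G -> x \notin inames D') ->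
  ilc (D1 ++ irename (addn b) D2 ++ D') M sg B ->
  exists r, [/\ forall x, x \in bnames G -> r (b + x) = x,
     forall z, (forall x, x \in bnames G -> z <> b + x) -> r z = z
   & ilc (D ++ D') (rn (ren r) M) sg B].
Proof.
elim: G P u D D1 D2 D' M => [|e G IH] P u D D1 D2 D' M /=.
  move=> -> -> -> _ _ _ /= h; exists id; split=> //.
  suff -> : ren id = id by rewrite rn_id.
  by apply: functional_extensionality => -[].
move=> [chi [D0 [-> brc rc]]] [phi [D10 [-> brp rp]]] [psi [D20 [-> brq rq]]].
move=> /andP[eG uG] ltb dis /= h.
set x := bname e in eG ltb dis h *.
have xb : x < b by apply: ltb; rewrite inE eqxx.
have nGx z : z \in bnames G -> z != x by apply: contraTneq => ->.
have {}h : ilc [:: IEntry x phi (Bang (fun i : {i | P (inl i)} => u (inl (sval i)))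
                                 (restrict_formula (fun i => P (inl i)) (bform e))),
              IEntry (b + x) psi (Bang (fun i : {i | ~~ P (inl i)} => u (inl (sval i)))
                                 (restrict_formula (fun i => ~~ P (inl i)) (bform e)))
            & D10 ++ irename (addn b) D20 ++ D'] M sg B.
  apply: iexch h _; apply: perm_skip; symmetry; exact: Permutation_middle.
have xn : x \notin inames (D10 ++ irename (addn b) D20 ++ D').
  rewrite /inames !map_cat -!/(inames _) inames_irename (realizes_names rp) (realizes_names rq).
  rewrite !mem_cat !bnames_split (negbTE eG) /= negb_or (dis x) ?inE ?eqxx // andbT.
  by apply/mapP => -[z _ E]; move: xb; rewrite E ltnNge leq_addr.
have {}h := i_contr (u := fun i => u (inl i)) (P := fun i => P (inl i)) xn (bracket_contr brc brp brq) h.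
(* The contracted entry joins [D'], so that the induction hypothesis finds the remaining halves in
   front. *)
have {}h : ilc (D10 ++ irename (addn b) D20 ++
    (IEntry x chi (Bang (fun i => u (inl i)) (bform e)) :: D')) (merge_vars x (b + x) x M) sg B.
  by apply: iexch h _; rewrite !catA; apply: Permutation_middle.
have [z zG|z zG|r [r1 r2 r3]] := IH _ _ _ _ _ _ _ rc rp rq uG _ _ h.
- by apply: ltb; rewrite inE zG orbT.
- by rewrite inE negb_or nGx // dis // inE zG orbT.
exists (r \o (fun n => if (n == x) || (n == b + x) then x else n)); split.
- move=> z; rewrite inE => /predU1P[->|zG] /=.
    rewrite eqxx orbT; apply: r2 => w _ E; move: xb; by rewrite E ltnNge leq_addr.
  rewrite eqn_add2l (negbTE (nGx z zG)) orbF ifF ?r1 //.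
  by apply/eqP => E; move: xb; rewrite -E ltnNge leq_addr.
- move=> z hz /=; rewrite [z == b + x]negbTE ?orbF; last by apply/eqP/hz; rewrite inE eqxx.
  have rz : r z = z by apply: r2 => w wG; apply: hz; rewrite inE wG orbT.
  by case: eqP => [<-|].
- move: r3; rewrite merge_rn rn_comp => h'; apply: iexch; last first.
    by apply: Permutation_sym; apply: Permutation_middle.
  suff -> : ren (r \o (fun n => if (n == x) || (n == b + x) then x else n)) =
     ren r \o ren (fun n => if (n == x) || (n == b + x) then x else n) by [].
  by apply: functional_extensionality => -[].
Qed.

(** Permuting entries permutes the summands of the type of resources, so the function on resources
    has to be transported along. *)
Lemma realizes_perm (Q : finType) (J : countType) (G G' : seq (bent Q)) (u : bres G -> J) D :
  Permutation G G' -> realizes u D ->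
  exists (u' : bres G' -> J) D', [/\ realizes u' D', Permutation D' D
    & matched (fun h => (lab (@blab Q) h, u h)) (fun h => (lab (@blab Q) h, u' h))].
Proof.
move=> p; elim: p u D => {G G'}.
- by move=> u D hD; exists u, D; split=> //; apply: matched_refl.
- move=> e G G' p IH u D /= [phi [D0 [-> br /IH[u' [D' [h1 h2 h3]]]]]].
  exists (fun h => match h with inl i => u (inl i) | inr h => u' h end).
  exists (IEntry (bname e) phi (Bang (fun i => u (inl i)) (bform e)) :: D'); split.
  + by exists phi, D'.
  + exact: perm_skip.
  + apply: (matched_map (r := id) _ _
      (matched_join (matched_refl (fun i : bidx e => (blab i, u (inl i)))) h3)); by case.
- move=> e f G u D /= [phi [_ [-> br1 [psi [D' [-> br2 hD]]]]]].
  exists (fun h => match h with inl i => u (inr (inl i)) | inr (inl i) => u (inl i)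
                           | inr (inr h) => u (inr (inr h)) end).
  eexists; split.
  + by exists psi; eexists; split=> //; exists phi, D'.
  + exact: perm_swap.
  + by apply: (@matched_bij _ _ _ _ _
      (fun h => match h with inl i => inr (inl i) | inr (inl i) => inl i | inr (inr h) => inr (inr h) end)
      (fun h => match h with inl i => inr (inl i) | inr (inl i) => inl i | inr (inr h) => inr (inr h) end));
      case=> [|[]].
- move=> G1 G2 G3 _ IH1 _ IH2 u D /IH1[u' [D' [/IH2[u'' [D'' [h1 h2 h3]]] h4 h5]]].
  exists u'', D''; split=> //; first exact: Permutation_trans h4.
  exact: matched_trans h5 h3.
Qed.

Lemma benv_perm (Q : finType) (G G' : seq (bent Q)) v k :
  Permutation G G' -> benv G v k -> benv G' v k.
Proof.
move=> p; elim: p => {G G'} //=.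
- by move=> e G G' _ IH [h|/IH h]; [left|right].
- by move=> e f G [h|[h|h]]; auto.
- by move=> G1 G2 G3 _ h1 _ h2 /h1.
Qed.

Lemma benv_head (Q : finType) (G : seq (bent Q)) v k :
  benv G v k -> exists e G', [/\ Permutation G (e :: G'), v = Fr (bname e) & k = kind_of (bform e)].
Proof.
elim: G => //= e G IH [[-> ->]|/IH[f [G' [p -> ->]]]]; first by exists e, G.
exists f, (e :: G'); split=> //; apply: Permutation_trans (perm_swap _ _ _).
exact: perm_skip.
Qed.

Lemma bnames_perm (Q : finType) (G G' : seq (bent Q)) :
  Permutation G G' -> uniq (bnames G) -> uniq (bnames G').
Proof.
move=> p; rewrite (@perm_uniq _ (bnames G) (bnames G')) //; elim: p => {G G'} //=.
- by move=> e G G' _; rewrite perm_cons.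
- by move=> e f G; apply: (permEl (perm_catCA [:: bname f] [:: bname e] _)).
- by move=> G1 G2 G3 _ h1 _; apply: perm_trans.
Qed.

(** * Spines: a variable applied to its arguments *)

Fixpoint spine_styp (D : var -> kind -> Prop) (k : kind) (Ns : seq term) (k' : kind) : Prop :=
  if Ns is N :: Ns' then exists k1 k2,
    [/\ k = KArr k1 k2, styp false D N k1 & spine_styp D k2 Ns' k']
  else k = k'.

Lemma spine_styp_rcons D k Ns N k1 k2 :
  spine_styp D k Ns (KArr k1 k2) -> styp false D N k1 -> spine_styp D k (rcons Ns N) k2.
Proof.
elim: Ns k => [|N' Ns IH] k /=; first by move=> -> hN; exists k1, k2.
by case=> l1 [l2 [-> h1 /IH h2]] hN; exists l1, l2; split=> //; apply: h2.
Qed.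

Lemma styp_spine D t k : styp true D t k ->
  exists v Ns k0, [/\ t = foldl TApp (tvar v) Ns, D v k0 & spine_styp D k0 Ns k].
Proof.
elim: t k => [n|x|t IH N _|M _] k //=.
- by case=> _ h; exists (Bd n), [::], k.
- by case=> _ h; exists (Fr x), [::], k.
- case=> _ [k' [/IH[v [Ns [k0 [-> h1 h2]]]] hN]].
  exists v, (rcons Ns N), k0; split=> //; first by rewrite foldl_rcons.
  exact: spine_styp_rcons h2 hN.
- by case.
Qed.

Lemma spine_styp_rn D k Ns k' r :
  (forall v l, D v l -> r v = v) -> spine_styp D k Ns k' -> map (rn r) Ns = Ns.
Proof.
move=> hr; elim: Ns k => //= N Ns IH k [k1 [k2 [_ hN /IH ->]]].
by congr (_ :: _); rewrite -[RHS]rn_id; apply: styp_rn_ext hN.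
Qed.

Fixpoint spine_uses (Q : finType) (H : Type) (l : H -> var * qtype Q Lin) (P : H -> Prop)
    (t : qtype Q Lin) (Ns : seq term) (t' : qtype Q Lin) : Prop :=
  if Ns is N :: Ns' then
    exists (phi : qtype Q Rep) (s : qtype Q Lin) (PP : option (qidx phi) -> H -> Prop),
      [/\ t = QArr phi s, splits P PP, forall p, uses l (PP (Some p)) N (@qmem Q Rep phi p)
        & spine_uses l (PP None) s Ns' t']
  else t = t' /\ forall h, ~ P h.

(** Unfolding the applications collects the blocks of all arguments in [P2], so that the head can be
    treated apart. *)
Lemma uses_spine (Q : finType) (H : Type) (l : H -> var * qtype Q Lin) (P : H -> Prop) t Ns s :
  uses l P (foldl TApp t Ns) s ->
  exists (P1 P2 : H -> Prop) tau,
    [/\ forall h, P h <-> P1 h \/ P2 h, forall h, P1 h -> P2 h -> False,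
        uses l P1 t tau & spine_uses l P2 tau Ns s].
Proof.
elim: Ns t => [|N Ns IH] t /=.
  move=> h; exists P, (fun _ => False), s; split=> //; first by move=> h'; tauto.
  by split=> // h' [].
case/IH=> P1 [P2 [tau [h1 h2 /= [phi [PP [[s1 s2] ht hN]]] hs]]].
exists (PP None), (fun h => P2 h \/ exists p, PP (Some p) h), (QArr phi tau); split=> //.
- move=> h; rewrite h1 s1; split; last first.
    by case=> [hn|[|[p hp]]]; [left; exists None|right|left; exists (Some p)].
  by case=> [[[p|] hp]|]; [right; right; exists p|left|right; left].
- move=> h hn [h'|[p hp]]; last by have := s2 _ _ _ hn hp.
  by apply: (h2 h) => //; apply/s1; exists None.
- exists phi, tau, (fun c => if c is Some p then PP (Some p) else P2); split=> //; split.
    move=> h; split=> [[hp|[p hp]]|[[p|] hp]]; [by exists None|by exists (Some p)|right|left] => //.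
    by exists p.
  move=> h [c|] [c'|] //; first by apply: s2.
    by move=> hc /h2 []; apply/s1; exists (Some c).
  by move=> h' hc; case: (h2 h) => //; apply/s1; exists (Some c').
Qed.

Lemma spine_uses_rel (Q : finType) (H H' : Type) (l : H -> var * qtype Q Lin)
    (l' : H' -> var * qtype Q Lin) (P : H -> Prop) (P' : H' -> Prop) R t Ns s :
  linked P P' R -> (forall h h', R h h' -> l' h' = l h) ->
  spine_uses l P t Ns s -> spine_uses l' P' t Ns s.
Proof.
elim: Ns P P' R t => [|N Ns IH] P P' R t lk hl /=.
  case=> -> h; split=> // h' /(linked_cod lk)[g gg]; case: (h g).
  by apply/(linked_dom lk); exists h'.
case=> phi [tau [PP [-> hs hN ht]]].
have lkc c : linked (PP c) (fun h' => exists2 h, PP c h & R h h')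
                    (fun h h' => PP c h /\ R h h').
  split.
  + move=> h; split=> [hc|[h' []]//].
    have [h' hh] : exists h', R h h' by apply/(linked_dom lk)/hs.1; exists c.
    by exists h'.
  + by move=> h'; split=> [[h hc hh]|[h [hc hh]]]; exists h.
  + by move=> k1 k2 h' [_ a] [_]; apply: linked_inj lk _ _ _ a.
  + by move=> h k1 k2 [_ a] [_]; apply: linked_fun lk _ _ _ a.
exists phi, tau, (fun c h' => exists2 h, PP c h & R h h'); split=> //.
- apply: splits_transport hs _ _.
    by move=> k1 k2 h' _ _; apply: linked_inj lk _ _ _.
  move=> h'; rewrite (linked_cod lk); split=> [[h hh]|[h _ hh]]; exists h => //.
  by apply/(linked_dom lk); exists h'.
- by move=> p; apply: uses_rel (lkc _) _ (hN p) => h h' [_]; apply: hl.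
- by apply: IH (lkc None) _ ht => h h' [_]; apply: hl.
Qed.

Lemma linked_ext (H : Type) (P P' : H -> Prop) :
  (forall h, P h <-> P' h) -> linked P P' (fun h h' => P h /\ h = h').
Proof.
move=> e; split.
- by move=> h; split=> [hp|[h' []]//]; exists h.
- by move=> h; rewrite -e; split=> [hp|[h' [hp <-]]] //; exists h.
- by move=> a b c [_ ->] [_ ->].
- by move=> a b c [_ <-] [_ <-].
Qed.

Lemma uses_ext (Q : finType) (H : Type) (l : H -> var * qtype Q Lin) (P P' : H -> Prop) M s :
  (forall h, P h <-> P' h) -> uses l P M s -> uses l P' M s.
Proof. by move=> e; apply: uses_rel (linked_ext e) _ => h h' [_ <-]. Qed.

Lemma spine_uses_ext (Q : finType) (H : Type) (l : H -> var * qtype Q Lin) (P P' : H -> Prop) t Ns s :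
  (forall h, P h <-> P' h) -> spine_uses l P t Ns s -> spine_uses l P' t Ns s.
Proof. by move=> e; apply: spine_uses_rel (linked_ext e) _ => h h' [_ <-]. Qed.

(* One application of a family of heads: [o] sends each resource to the copy of
   the argument that consumes it, or to None if the rest of the spine does. *)
Lemma spine_uses_cons (Q : finType) (H : Type) (J I : countType) (l : H -> var * qtype Q Lin)
    (u : H -> J) (w : I -> J) (tau1 : I -> qtype Q Lin) (phi : J -> qtype Q Rep)
    (sg rho : J -> qtype Q Lin) N Ns :
  is_bracket w (fun i => bullet (tau1 i)) (fun j => bullet (phi j)) ->
  (forall j, spine_uses l (fun h => u h = j) (QArr (phi j) (sg j)) (N :: Ns) (rho j)) ->
  exists o : H -> option I,
    [/\ forall h i, o h = Some i -> w i = u h,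
        forall i, uses l (fun h => o h = Some i) N (tau1 i)
      & forall j, spine_uses l (fun h => u h = j /\ o h = None) (sg j) Ns (rho j)].
Proof.
move=> /bracket_bulletP br hs.
(* Blocks are reindexed from the members of [phi j] to [I], so that the copies of the argument at
   all [j] share one index set. *)
have {hs} /choice[PP hPP] j : exists PP : option I -> H -> Prop,
    [/\ splits (fun h => u h = j) PP, forall i h, PP (Some i) h -> w i = j,
        forall i, w i = j -> uses l (PP (Some i)) N (tau1 i)
      & spine_uses l (PP None) (sg j) Ns (rho j)].
  have [phi' [s' [PP [E [s1 s2] h2 h3]]]] := hs j; have [e [e1 e2 e3 e4]] := br j.
  injection E => E1 E2; subst phi' s'.
  exists (fun c h => if c is Some i then exists2 p, e p = i & PP (Some p) h else PP None h).
  split=> //.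
  - split.
      move=> h; rewrite s1; split=> [[[p|] hp]|[[i|] hp]].
      + by exists (Some (e p)); exists p.
      + by exists None.
      + by case: hp => p _ hp; exists (Some p).
      + by exists None.
    move=> h [i|] [i'|] //=.
    + by case=> p <- hp [p' <- /(s2 _ _ _ hp)[->]].
    + by case=> p _ hp /(s2 _ _ _ hp).
    + by move=> hp [p _ /(s2 _ _ _ hp)].
  - by move=> i h [p <-].
  - move=> i /e3[p <-]; rewrite -e4; apply: uses_ext (h2 p) => h.
    by split=> [hp|[p' /e1 -> //]]; exists p.
(* A resource lies in the fiber of its own index [u h], and the partition of that fiber determines
   its block. *)
have /choice[o ho] h : exists c, PP (u h) c h.
  by have [[s1 _] _ _ _] := hPP (u h); apply/s1.
have PPo j c h : PP j c h <-> u h = j /\ o h = c.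
  have [[s1 s2] _ _ _] := hPP j; split=> [hc|[<- <-]] //.
  have E : u h = j by apply/s1; exists c.
  by split=> //; subst j; apply: s2 (ho h) hc.
exists o; split.
- by move=> h i E; have [_ h2 _ _] := hPP (u h); apply: (h2 _ h); apply/PPo.
- move=> i; have [_ h2 h3 _] := hPP (w i); apply: uses_ext (h3 _ erefl) => h.
  rewrite PPo; split=> [[]//|E]; split=> //.
  have [_ h2' _ _] := hPP (u h); symmetry; apply: (h2' _ h); exact/PPo.
- by move=> j; have [_ _ _ h4] := hPP j; apply: spine_uses_ext h4 => h; rewrite PPo.
Qed.

(** Isolated as a property of one term, so that the lemmas on spines can assume it for the arguments
    alone. *)
Definition family_derivable (Q : finType) (M : term) : Prop :=
  forall (J : countType) (G : seq (bent Q)) (u : bres G -> J) (D : ictx Q J)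
    (sg : J -> qtype Q Lin) B,
  realizes u D -> uniq (bnames G) -> refines B (fun j => bullet (sg j)) ->
  styp false (benv G) M (kind_of B) ->
  (forall j, uses (lab (@blab Q) (s := G)) (fun h => u h = j) M (sg j)) ->
  ilc D M (fun j => bullet (sg j)) B.

Lemma seq_bound (s : seq nat) : exists b, forall x, x \in s -> x < b.
Proof.
elim: s => [|x s [b hb]]; first by exists 0.
exists (maxn x.+1 b) => y; rewrite inE leq_max => /predU1P[->|/hb ->]; rewrite ?leqnn ?orbT //.
Qed.

Lemma subst_fresh x t M : x \notin fn M -> subst x t M = M.
Proof.
elim: M => [n|y|M1 IH1 M2 IH2|M IH] //=.
- by rewrite inE eq_sym => /negbTE ->.
- by rewrite mem_cat negb_or => /andP[/IH1 -> /IH2 ->].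
- by move=> /IH ->.
Qed.

Lemma subst_foldl x t s Ns :
  x \notin flatten (map fn Ns) -> subst x t (foldl TApp s Ns) = foldl TApp (subst x t s) Ns.
Proof.
elim: Ns s => //= N Ns IH s; rewrite mem_cat negb_or => /andP[h1 /IH ->] /=.
by rewrite (subst_fresh _ h1).
Qed.

Lemma rn_foldl r t Ns : rn r (foldl TApp t Ns) = foldl TApp (rn r t) (map (rn r) Ns).
Proof. by elim: Ns t => //= N Ns IH t; rewrite IH. Qed.

(** Each argument costs one left rule: its context holds the resources sent to some copy, the rest
    of the spine takes the others, and a fresh [y'] stands for [y] applied to the argument. Both
    parts keep all names, so one is shifted by [b] and the two are contracted afterwards. *)
Lemma spine_ilc (Q : finType) (Ns : seq term) (J : countType) (G : seq (bent Q))
    (u : bres G -> J) (D : ictx Q J) y (sg : J -> qtype Q Lin) A (q : J -> Q) :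
  (forall N, In N Ns -> family_derivable Q N) ->
  realizes u D -> uniq (y :: bnames G) -> refines A (fun j => bullet (sg j)) ->
  spine_styp (benv G) (kind_of A) Ns KBase ->
  (forall j, spine_uses (lab (@blab Q) (s := G)) (fun h => u h = j) (sg j) Ns (QState (q j))) ->
  ilc (IEntry y (fun j => bullet (sg j)) A :: D) (foldl TApp (TFree y) Ns)
    (fun j => IState (q j)) Bot.
Proof.
elim: Ns G u D y sg A => [|N Ns IH] G u D y sg A fam hD yG hA.
  (* Without arguments nothing consumes a resource, so there are none and the whole context is
     weakened into the axiom. *)
  move=> /= /kind_base E hu; subst A.
  have -> : (fun j => bullet (sg j)) = (fun j => IState (q j)).
    by apply: functional_extensionality => j; case: (hu j) => ->.
  have := i_ax y q.
  move/(weaken_context (D' := [:: _]) hD) => h.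
  apply: (iexch (h _ _)); last by apply: Permutation_sym; apply: Permutation_cons_append.
    by move=> g; case: (hu (u g)) => _ /(_ g) [].
  by move: yG; rewrite cat_uniq /= orbF andbT andbC.
case=> k1 [k2 [/kind_arr[I [w [B [C [EA <- <-]]]]] tN tNs]]; subst A => hu.
have [phi [tau [E hB hC]]] := refines_lolli_bullet hA; subst sg.
have [tau1 hB1 brw] := refines_bang_bullet hB.
have {hu} [o [o1 o2 o3]] := spine_uses_cons brw hu.
(* The resources of the rest of the spine; the complement goes to the copies of [N]. *)
pose P h := ~~ isSome (o h).
have [D0 hD0] := realizes_ex (fun h : bres (bsplit P) => u (binj h)).
have /choice[u1 hu1] (h : bres (bsplit (fun h => ~~ P h))) : exists i, o (binj h) = Some i.
  by have := binjP h; rewrite negbK; case: (o _) => // i _; exists i.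
(* On the part of the argument [u] factors through [w], which lets [N] be derived over its copies
   and promoted along [w]. *)
have Ewu : (fun h => u (binj h)) = w \o u1.
  by apply: functional_extensionality => h /=; rewrite -(o1 _ _ (hu1 h)).
have [D2 hD2] := realizes_ex (w \o u1).
have [D1 hD1 prom] := realizes_promote hD2.
have [b hb] := seq_bound (y :: bnames G).
(* [y'] also avoids the remaining arguments, so that substituting for it acts on the head only. *)
have [y' hy'] := seq_bound (y :: bnames G ++ flatten (map fn Ns)).
move: (yG) => /= /andP[yG1 uG].
have famN : ilc D1 N (fun i => bullet (tau1 i)) B.
  apply: (fam _ _ _ _ _ _ _ _ hD1) => //; first by left.
  - by rewrite bnames_split.
  - by rewrite benv_split.
  - move=> i; apply: (uses_rel (R := fun h h' => binj h' = h /\ u1 h' = i)) (o2 i).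
      split.
      - move=> h; split=> [oh|[h' [<- <-]]]; last by rewrite hu1.
        have [|h' E] := @binj_onto _ _ (fun h => ~~ P h) h; first by rewrite /P oh.
        by exists h'; split=> //; have := hu1 h'; rewrite E oh => -[].
      - by move=> h'; split=> [E|[h []]//]; exists (binj h').
      - by move=> a a' c [<- _] [<- _].
      - by move=> a c c' [<- _] [/binj_inj -> _].
    by move=> h h' [<- _]; rewrite lab_binj.
have {}famN := i_prom prom brw famN.
have {}famN := ilc_rename (@addnI b) famN.
have hNs : ilc (IEntry y' (fun j => bullet (tau j)) C :: D0) (foldl TApp (TFree y') Ns)
               (fun j => IState (q j)) Bot.
  apply: IH hD0 _ hC _ _.
  - by move=> N' hN'; apply: fam; right.
  - rewrite /= bnames_split uG andbT; apply/negP => h.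
    by have := hy' y'; rewrite ltnn inE mem_cat h orbT => /(_ isT).
  - by rewrite benv_split.
  - move=> j; apply: (spine_uses_rel (R := fun h h' => binj h' = h /\ u h = j)) (o3 j).
      split.
      - move=> h; split=> [[uh oh]|[h' [<- <-]]]; last first.
          by split=> //; have := binjP h'; rewrite /P; case: (o _).
        have [|h' E] := @binj_onto _ _ P h; first by rewrite /P oh.
        by exists h'.
      - by move=> h'; split=> [E|[h [<-]]//]; exists (binj h').
      - by move=> a a' c [<- _] [<- _].
      - by move=> a c c' [<- _] [/binj_inj -> _].
    by move=> h h' [<- _]; rewrite lab_binj.
have {famN hNs} := i_left (f := y) _ famN hNs.
rewrite subst_foldl /=; last first.
  apply/negP => h; by have := hy' y'; rewrite ltnn inE mem_cat h !orbT => /(_ isT).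
rewrite eqxx => h.
have ltb x : x \in bnames G -> x < b by move=> xG; apply: hb; rewrite inE xG orbT.
have yb : y < b by apply: hb; rewrite inE eqxx.
have {}h : ilc (D0 ++ irename (addn b) D2 ++
     [:: IEntry y (fun j => bullet (QArr (phi j) (tau j))) (Lolli (Bang w B) C)])
     (foldl TApp (TApp (TFree y) (rn (ren (addn b)) N)) Ns) (fun j => IState (q j)) Bot.
  apply: iexch; first apply: h.
    rewrite /inames map_cat -!/(inames _) inames_irename (realizes_names hD0) (realizes_names hD2).
    rewrite !bnames_split cat_uniq (map_inj_uniq (@addnI b)) uG !andbT /= mem_cat negb_or.
    rewrite yG1 andbT; apply/andP; split.
      by apply/mapP => -[z _ E]; move: yb; rewrite E ltnNge leq_addr.
    apply/hasPn => z zG; apply/mapP => -[z' _ E]; by move: (ltb _ zG); rewrite E ltnNge leq_addr.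
  apply: Permutation_trans (Permutation_cons_append _ _) _; rewrite catA.
  apply: Permutation_app_tail; exact: Permutation_app_comm.
have [||r [r1 r2]] := contract_context (D' := [:: _]) hD hD0 _ uG ltb _ h.
- by rewrite Ewu.
- by move=> x xG; rewrite inE; apply: contraTneq xG => ->.
(* [r] moves only shifted names: the remaining arguments are untouched, while in [N] it undoes the
   shift. *)
have rG v k : benv G v k -> ren r v = v.
  case/benv_name => x -> xG /=; rewrite r2 // => z zG E.
  by move: (ltb _ xG); rewrite E ltnNge leq_addr.
rewrite rn_foldl /= (spine_styp_rn rG tNs) r2; last first.
  by move=> z _ E; move: yb; rewrite E ltnNge leq_addr.
have -> : rn (ren r) (rn (ren (addn b)) N) = N.
  rewrite rn_comp -[RHS]rn_id; apply: styp_rn_ext tN => v k /benv_name[x -> xG] /=.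
  by rewrite r1.
by move=> h'; apply: iexch h' _; apply: Permutation_sym; apply: Permutation_cons_append.
Qed.

Lemma term_size_spine N t Ns : In N Ns -> term_size N < term_size (foldl TApp t Ns).
Proof.
have le s Ks : term_size s <= term_size (foldl TApp s Ks).
  elim: Ks s => //= K Ks IH s; apply: leq_trans (IH _).
  by rewrite /= -addnS leq_addr.
elim: Ns t => //= K Ns IH t [->|h]; last exact: IH.
by apply: leq_trans (le _ _); rewrite /= ltnS leq_addl.
Qed.

(* The head of the spine is contracted out of its variable, and derelicted: this
   moves the whole sequent to the index set of the restricted formula. *)
Lemma neutral_ilc (Q : finType) (Ns : seq term) (J : countType) (e : bent Q) (G : seq (bent Q))
    (u : bres (e :: G) -> J) (D : ictx Q J) (q : J -> Q) :
  (forall N, In N Ns -> family_derivable Q N) ->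
  realizes u D -> uniq (bnames (e :: G)) ->
  spine_styp (benv (e :: G)) (kind_of (bform e)) Ns KBase ->
  (forall j, uses (lab (@blab Q) (s := e :: G)) (fun h => u h = j)
               (foldl TApp (TFree (bname e)) Ns) (QState (q j))) ->
  ilc D (foldl TApp (TFree (bname e)) Ns) (fun j => IState (q j)) Bot.
Proof.
move=> fam [chi [D0 [-> br hD]]] uG tNs hu.
have /andP[eG uG'] := uG.
(* [d j] is the resource that the head consumes in the typing at [j]; names being distinct, it
   belongs to the entry [e]. *)
have {hu} /choice[d hd] j : exists d : bidx e, u (inl d) = j /\
    spine_uses (lab (@blab Q) (s := e :: G)) (fun h => u h = j /\ h <> inl d)
      (bsig d) Ns (QState (q j)).
  have [P1 [P2 [tau [h1 h2 [h El hP1] hs]]]] := uses_spine (hu j).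
  have uh : u h = j by apply/h1; left; apply/hP1.
  case: h El hP1 uh => [d|h] /= El hP1 uh; last first.
    have [x Ex xG] := lab_name h; rewrite El in Ex; case: Ex => Ex.
    by case/negP: eG; rewrite Ex.
  case: El => El; subst tau; exists d; split=> //; apply: spine_uses_ext hs => h.
  rewrite h1 hP1; split=> [hp|[[->|//] []//]]; split; first by right.
  by move=> E; apply: (h2 h) => //; apply/hP1.
(* Exactly one index of [e] per [j] is a head, so [f] and [g] below are inverse to each other and
   dereliction applies. *)
pose P i := i == d (u (inl i)).
have Pd j : P (d j) by rewrite /P (hd j).1.
pose I : countType := {i | P i}.
pose f (i : I) : J := u (inl (sval i)).
pose g (j : J) : I := exist _ (d j) (Pd j).
have fg : cancel f g by move=> i; apply: val_inj; apply/esym/eqP/(svalP i).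
have gf : cancel g f by move=> j; apply: (hd j).1.
have [y hy] : exists y, y \notin bnames (e :: G) ++ flatten (map fn Ns).
  have [b hb] := seq_bound (bnames (e :: G) ++ flatten (map fn Ns)).
  by exists b; apply/negP => /hb; rewrite ltnn.
move: hy; rewrite mem_cat negb_or => /andP[yG yNs].
pose e' := brestrict (fun i => ~~ P i) : bent Q.
pose u' (h : bres (e' :: G)) := match h with inl i => u (inl (sval i)) | inr h => u (inr h) end.
have [phi brp] : exists phi : J -> itype Q Rep, is_bracket f (fun i => bullet (bsig (sval i))) phi.
  by eexists; apply: bracket_is_bracket.
have [psi brq] : exists psi : J -> itype Q Rep,
    is_bracket (fun i : {i | ~~ P i} => u (inl (sval i))) (fun i => bullet (bsig (sval i))) psi.
  by eexists; apply: bracket_is_bracket.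
have hD' : realizes u' (IEntry (bname e) psi
    (Bang (fun i : {i | ~~ P i} => u (inl (sval i))) (restrict_formula (fun i => ~~ P i) (bform e))) :: D0).
  by exists psi, D0.
(* The head occurrence gets the fresh name [y]; contraction with the rest of [e] restores the
   original name. *)
suff h : ilc [:: IEntry y phi (Bang f (restrict_formula P (bform e))),
    IEntry (bname e) psi (Bang (fun i : {i | ~~ P i} => u (inl (sval i)))
       (restrict_formula (fun i => ~~ P i) (bform e))) & D0]
    (foldl TApp (TFree y) Ns) (fun j => IState (q j)) Bot.
  have en : bname e \notin inames D0 by rewrite (realizes_names hD).
  have := i_contr (u := fun i => u (inl i)) (P := P) en (bracket_contr br brp brq) h.
  rewrite merge_rn rn_foldl /= eqxx /=.
  rewrite (_ : map _ Ns = Ns) //; apply: spine_styp_rn tNs => v k /benv_name[x -> xG] /=.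
  by congr Fr; case: (x =P y) => [E|_]; [rewrite -E xG in yG|case: eqP].
apply: (i_der fg gf brp).
apply: (spine_ilc fam (realizes_reindex fg gf hD')).
- by rewrite /= -/(bnames _); apply/andP; split.
- exact: refines_restrict (brefines e).
- by rewrite kind_of_restrict /= kind_of_restrict.
- move=> i; have [_] := hd (f i).
  have -> : d (f i) = sval i by have := fg i => /(congr1 sval).
  apply: (spine_uses_rel (R := fun h h' => u' h' = f i /\
     match h, h' with inl a, inl b => a = sval b | inr a, inr b => a = b | _, _ => False end)).
    split.
    + case=> [a|a]; split.
      * case=> ua ne; have Pa : ~~ P a.
          apply/negP => /eqP Pa; apply: ne; congr inl; rewrite Pa ua.
          by have := fg i => /(congr1 sval).
        by exists (inl (exist _ a Pa)).
      * case=> -[b|b] [] //= ub E; subst a; split=> // -[E].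
        by have := svalP b; rewrite /= E (svalP i).
      * by case=> ua _; exists (inr a).
      * by case=> -[b|b] [] //= ub ->.
    + case=> [b|b] /=; split.
      * by move=> E; exists (inl (sval b)); split=> //=; rewrite -(gf (u _)) [g _]E.
      * by case=> -[a|a] [] // E _; rewrite /= [u _]E fg.
      * by move=> E; exists (inr b); split=> //=; rewrite -(gf (u _)) [g _]E.
      * by case=> -[a|a] [] // E _; rewrite /= [u _]E fg.
    + by move=> [a|a] [b|b] [c|c] [_ E] [_ E'] //; rewrite E E'.
    + move=> [a|a] [b|b] [c|c] [_ E] [_ E'] //; last by rewrite -E E'.
      by congr inl; apply: val_inj; rewrite /= -E E'.
  by move=> [a|a] [b|b] [_ E] //; rewrite E.
Qed.

(** At base kind the formula is [Bot] and the term is a spine, whose arguments are smaller; at an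
    arrow kind eta-longness makes it an abstraction. *)
Lemma family_ilc (Q : finType) (M : term) : family_derivable Q M.
Proof.
have [n] := ubnP (term_size M); elim: n M => // n IH M lt.
move=> J G u D sg B hD uG hB tM hu.
have neutral : styp true (benv G) M KBase -> B = Bot -> ilc D M (fun j => bullet (sg j)) B.
  move=> {}tM EB; subst B.
  have [q E] := refines_bot_bullet hB; subst sg.
  have [v [Ns [k [EM bk tNs]]]] := styp_spine tM; subst M.
  have [e [G' [p Ev Ek]]] := benv_head bk; subst v k.
  have [u' [D' [hD' pD /matched_fun[f [g [fg gf E]]]]]] := realizes_perm p hD.
  apply: i_exchange pD _; apply: neutral_ilc (hD') _ _ _.
  - by move=> N hN; apply: IH; have := term_size_spine (tvar (Fr (bname e))) hN => /leq_trans; apply.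
  - exact: bnames_perm p uG.
  - move: tNs; elim: (Ns) (kind_of (bform e)) => //= N Ns' IHs k [k1 [k2 [-> h1 /IHs h2]]].
    exists k1, k2; split=> //; rewrite -(rn_id N); apply: styp_rn h1 => v k'.
    exact: benv_perm p.
  - move=> j; apply: (uses_rel (R := fun h h' => u h = j /\ f h = h')) (hu j).
      split.
      + by move=> h; split=> [uh|[h' []]//]; exists (f h).
      + move=> h'; split=> [uh|[h [<- <-]]]; last by case: (E h).
        by exists (g h'); split; [rewrite -uh -{2}(gf h'); case: (E (g h'))|apply: gf].
      + by move=> a b c [_ <-] [_ /(can_inj fg)].
      + by move=> a b c [_ <-] [_ <-].
    by move=> h h' [_ <-]; case: (E h).
case: M lt tM hu neutral => [n'|x|t N|M0] lt /= tM hu neutral.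
- by case: tM => _ /benv_name[].
- by case: tM => -[//|/[dup] E /kind_base EB] h; apply: neutral => //; rewrite -E; split=> //; left.
- by case: tM => -[//|/[dup] E /kind_base EB] h; apply: neutral => //; rewrite -E; split=> //; left.
case: tM => _ [k1 [k2 [/kind_arr[I [w [B1 [C [EB <- <-]]]]] tM]]]; subst B => {neutral}.
have [phi [tau [E hR hC]]] := refines_lolli_bullet hB; subst sg.
have [tau1 hB1 brw] := refines_bang_bullet hR.
have [x hx] : exists x, x \notin bnames G ++ fn M0.
  have [b hb] := seq_bound (bnames G ++ fn M0).
  by exists b; apply/negP => /hb; rewrite ltnn.
move: hx; rewrite mem_cat negb_or => /andP[xG xM].
rewrite -(close_open 0 xM) -/(lam x _); apply: i_right.
pose e := Bent x hB1.
(* The given formula already fixes the resources of the bound variable and, through [w], the index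
   at which each is consumed. *)
pose u' (h : bres (e :: G)) := match h with inl i => w i | inr h => u h end.
apply: (IH _ _ _ (e :: G) u').
- by rewrite term_size_rn.
- by exists (fun j => bullet (phi j)), D.
- by rewrite /= xG.
- exact: hC.
- apply: styp_rn tM => -[[|n']|y] k /=; last by right.
    by move=> ->; left.
  by case/benv_name.
- move=> j; have [phi' [s' [E hs]]] := hu j; injection E => E1 E2; subst phi' s'.
  move/bracket_bulletP: brw => /(_ j)[a [a1 a2 a3 a4]].
  apply: (uses_rn (R := fun h h' => match h, h' with
     | inl h, inr h' => h = h' /\ u h = j | inr p, inl i => a p = i | _, _ => False end)) hs.
  + split.
    * case=> [h|p]; last by split=> // _; exists (inl (a p)).
      by split=> [uh|[[i|h'] []//]]; exists (inr h).
    * case=> [i|h] /=; split.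
      - by move/a3 => [p <-]; exists (inr p).
      - by case=> -[h|p] // <-.
      - by exists (inl h).
      - by case=> -[h'|p] // [->].
    * move=> [h1|p1] [h2|p2] [i|h] //; first by move=> [-> _] [-> _].
      by move=> <- /a1 ->.
    * move=> [h|p] [i1|h1] [i2|h2] //; first by move=> [<- _] [<- _].
      by move=> <- <-.
  + case=> [h|p] [i|h'] //=; last by move=> <-; rewrite a4.
    case=> <- _; have [z + _] := lab_name h.
    by case: (lab _ h) => v t /= ->.
Qed.

(** * From ILC to intersection types *)

Definition ierase (Q : finType) (J : countType) (G : ictx Q J) : seq (nat * kind) :=
  [seq (iname e, kind_of (iform e)) | e <- G].

(** The right rule for intersections asks for a simple typing of its conclusion; over an empty fiber
    of a promotion no premise could provide it. *)
Lemma ilc_simply_typed (Q : finType) (J : countType) (G : ictx Q J) M s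
    (sg : J -> itype Q s) A :
  ilc G M sg A -> simply_typed (ierase G) M (kind_of A).
Proof.
have fst_ierase (K : countType) (G' : ictx Q K) : map fst (ierase G') = inames G'
  by rewrite -map_comp.
elim=> {J G M s sg A}.
- by move=> J x q; constructor.
- by move=> J G G' M s sg B /(Permutation_map (fun e => (iname e, kind_of (iform e)))) p _;
     apply: simple_exchange.
- by move=> J G x M phi sg R B _; apply: simple_right.
- move=> J G1 G2 f x M N phi sg s tau R B C u _ h1 _ h2 /=.
  rewrite /ierase map_cat; apply: simple_left h1 h2.
  by rewrite -map_cat fst_ierase.
- by move=> J E u A G x M phi s sg B xG _ _ _; apply: simple_weak; rewrite fst_ierase.
- move=> J I u A P G x y z M phi psi chi s sg B xG _ _ /=.
  by rewrite !kind_of_restrict; apply: simple_contr; rewrite fst_ierase.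
- move=> J K u v A G x M sg phi s tau B _ _ _ _ /=; rewrite kind_of_reindex.
  rewrite /ierase /ireindex -map_comp; congr (simply_typed (_ :: _) _ _).
  by apply: eq_map => e /=; rewrite kind_of_reindex.
- move=> J L v G G' M tau psi B f2 _ _; congr (simply_typed _ _ _).
  by elim: f2 => //= _ _ G0 G1 [x I u A sg phi psi' _ _ _] _ ->.
Qed.

Lemma dagger_entry_inv (Q : finType) (J : countType) (j : J) (e : ientry Q J) qe :
  dagger_entry j e qe ->
  exists2 t, bullet t = ity e j & qe = QEntry (iname e) t (kind_of (iform e)).
Proof. by case=> x s sg A t h; exists t. Qed.

Lemma dagger_cons_inv (Q : finType) (J : countType) (j : J) (e : ientry Q J) G G' :
  dagger j (e :: G) G' ->
  exists t G'', [/\ bullet t = ity e j,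
    G' = QEntry (iname e) t (kind_of (iform e)) :: G'' & dagger j G G''].
Proof.
move=> h; inversion_clear h as [|? qe ? G'' h1 h2].
by have [t ht ->] := dagger_entry_inv h1; exists t, G''.
Qed.

Lemma dagger_cons (Q : finType) (J : countType) (j : J) x s (sg : J -> itype Q s) A t k G G' :
  bullet t = sg j -> k = kind_of A -> dagger j G G' ->
  dagger j (IEntry x sg A :: G) (QEntry x t k :: G').
Proof. by move=> h -> hG; constructor. Qed.

Lemma dagger_names (Q : finType) (J : countType) (j : J) (G : ictx Q J) G' :
  dagger j G G' -> qnames G' = inames G.
Proof. by elim=> //= e qe G0 G1 /dagger_entry_inv[t _ ->] _ /= ->. Qed.

Lemma dagger_erase (Q : finType) (J : countType) (j : J) (G : ictx Q J) G' :
  dagger j G G' -> qerase G' = ierase G.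
Proof. by elim=> //= e qe G0 G1 /dagger_entry_inv[t _ ->] _ /= ->. Qed.

Lemma dagger_reindex (Q : finType) (J K : countType) (u : J -> K) (v : K -> J) k
    (G : ictx Q K) G' :
  cancel v u -> dagger k G G' -> dagger (v k) (ireindex u v G) G'.
Proof.
move=> vu; elim=> [|e qe G0 G1 /dagger_entry_inv[t ht ->] _ IH] /=; first by constructor.
by apply: dagger_cons => //=; rewrite ?vu ?kind_of_reindex.
Qed.

Lemma finite_index_inj (J K : countType) (f : J -> K) :
  injective f -> finite_index K -> finite_index J.
Proof.
move=> fi [s hs].
have /choice[g hg] b : exists o : option J, forall a, f a = b <-> o = Some a.
  case: (classic (exists a, f a = b)) => [[a <-]|h].
    by exists (Some a) => c; split=> [/fi ->|[->]].
  by exists None => a; split=> // E; case: h; exists a.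
exists (pmap g s) => j; rewrite mem_pmap; apply/mapP; exists (f j) => //.
by apply/esym/hg.
Qed.

Lemma qidx_finite (Q : finType) (t : qtype Q Rep) : finite_index (qidx t).
Proof. by dependent destruction t. Qed.

(** A compound type that embeds into a finite one is finite, hence a translation. This recovers
    intersection types in premises, where a type is only known to be part of one in the
    conclusion. *)
Lemma bullet_ex (Q : finType) (p : itype Q Rep) (t : qtype Q Rep) (f : iidx p -> qidx t) :
  injective f -> (forall a, @imem Q Rep p a = bullet (@qmem Q Rep t (f a))) ->
  exists p', bullet p' = p.
Proof.
dependent destruction p => /= fi hf.
exists (QInter (finite_index_inj fi (qidx_finite t)) (fun a => @qmem Q Rep t (f a))) => /=.
by congr IFam; apply: functional_extensionality => a; rewrite -hf.
Qed.

Lemma bracket_at (Q : finType) (I K : countType) (u : I -> K) (sg : I -> itype Q Lin)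
    (phi : K -> itype Q Rep) k t :
  is_bracket u sg phi -> bullet t = phi k ->
  exists e : qidx t -> I,
    [/\ injective e, forall a, u (e a) = k, forall i, u i = k -> exists a, e a = i
      & forall a, bullet (@qmem Q Rep t a) = sg (e a)].
Proof.
move=> /is_bracketP/(_ k) h E; move: h; rewrite -E => -[e [h1 h2 h3 h4]].
have [f [g [fg gf F]]] := matched_fun (iidx_bullet t).
exists (e \o g); split=> /=.
- exact: inj_comp h1 (can_inj gf).
- by [].
- by move=> i /h3[a <-]; exists (f a); rewrite fg.
- by move=> a; rewrite -h4 -F gf.
Qed.

(** [js] enumerates the fiber of [v] over [l]. The members of an entry at [l] are the indices in [I]
    over [l]; sorting them by their value under [u] splits the entry into those at the points
    [js a]. *)
Lemma promote_inter (Q : finType) (J L : countType) (v : J -> L) l (X : countType) (js : X -> J)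
    (G : ictx Q J) (G0 : ictx Q L) Gq :
  injective js -> (forall a, v (js a) = l) -> (forall j, v j = l -> exists a, js a = j) ->
  Forall2 (ientry_promote v) G G0 -> dagger l G0 Gq ->
  exists2 Gs : X -> qctx Q, qctx_inter Gs Gq & forall a, dagger (js a) G (Gs a).
Proof.
move=> ji jv jo f2; elim: f2 Gq => [|_ _ {}G {}G0 [x I u A sg phi psi hA brp brq] _ IH] Gq.
  by move=> h; inversion_clear h; exists (fun => [::]); constructor.
case/dagger_cons_inv=> t [Gq' [/= ht -> /IH[Gs hGs hd]]].
have [e [e1 e2 e3 e4]] := bracket_at brq ht.
have /choice[phi' hphi] a : exists p, bullet p = phi (js a).
  move/is_bracketP: brp => /(_ (js a))[f [f1 f2 f3 f4]].
  have /choice[g hg] c : exists b, e b = f c by apply: e3; rewrite /= f2.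
  apply: (bullet_ex (t := t) (f := g)).
    by move=> c c' E; apply: f1; rewrite -!hg E.
  by move=> c; rewrite f4 e4 hg.
exists (fun a => QEntry x (phi' a) (kind_of A) :: Gs a); last first.
  by move=> a; apply: dagger_cons.
apply: qctx_inter_cons hGs; apply: matched_same_family.
have ef a := bracket_at brp (hphi a).
pose f a : qidx (phi' a) -> I := sval (constructive_indefinite_description _ (ef a)).
have hf a := svalP (constructive_indefinite_description _ (ef a)).
(* A member of [t] and a member of some [phi' a] are paired when they name the same index in [I]. *)
exists (fun b (p : {a : X & qidx (phi' a)}) => e b = f (tag p) (tagged p)).
  split.
  - move=> b; split=> // _.
    have [a ea] := jo _ (e2 b); have [_ _ f3 _] := hf a.
    by have [c hc] := f3 (e b) (esym ea); exists (existT _ a c).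
  - move=> [a c]; split=> // _; have [_ f2 _ _] := hf a.
    by apply: e3; rewrite /= f2.
  - by move=> b b' p <- /e1.
  - move=> b [a c] [a' c'] /= -> E.
    have [f1 f2 _ _] := hf a; have [_ f2' _ _] := hf a'.
    have ea : a = a' by apply: ji; rewrite -(f2 c) -(f2' c') -/(f a) -/(f a') E.
    by subst a'; rewrite (f1 _ _ E).
move=> b [a c] /= E; have [_ _ _ f4] := hf a.
by apply: bullet_inj; rewrite f4 e4 E.
Qed.

Lemma ilc_quant (Q : finType) (J : countType) (G : ictx Q J) M s
    (sg : J -> itype Q s) A :
  ilc G M sg A -> forall j G' t, dagger j G G' -> bullet t = sg j -> quant G' M t (kind_of A).
Proof.
elim=> {J G M s sg A}.
- move=> J x q j G' t /dagger_cons_inv[t' [G'' [/bullet_state -> -> h]]] /bullet_state ->.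
  by inversion_clear h; constructor.
- move=> J G G' M s sg B p h IH j Gq t hd ht.
  have [Gq' [p' hd']] := Permutation_Forall2 (Permutation_sym p) hd.
  exact: (q_exchange (Permutation_sym p') (IH _ _ _ hd' ht)).
- move=> J G x M phi sg R B h IH j Gq t hd /bullet_arr[p [t' [-> hp ht]]] /=.
  by apply: q_right_arr; apply: (IH j) => //; apply: dagger_cons.
- move=> J G1 G2 f x M N phi sg s tau R B C un h1 IH1 h2 IH2 j Gq t.
  case/dagger_cons_inv=> t' [Gq' [/= /bullet_arr[p [r [-> hp hr]]] -> hd]] ht.
  have [Ga [Gb [ha [hb E]]]] := Forall2_app_inv_l _ _ hd; subst Gq'.
  apply: q_left_arr.
  + by rewrite (dagger_names hd).
  + by apply: (IH1 j).
  + by apply: (IH2 j) => //; apply: dagger_cons.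
- move=> J E u A G x M phi s sg B xG _ em h IH j Gq t.
  case/dagger_cons_inv=> t' [Gq' [/= E' -> hd]] ht; apply: q_weak.
  + by rewrite (dagger_names hd).
  + move=> i; have [f _] := matched_fun (matched_sym (iidx_bullet t')).
    by apply: (em j); rewrite -E'; apply: f.
  + by apply: (IH j).
- move=> J I u A P G x y z M phi psi chi s sg B xG sf h IH j Gq t.
  case/dagger_cons_inv=> t' [Gq' [/= E' -> hd]] ht.
  have mt : matched (fun i => bullet (@qmem Q Rep t' i))
      (join (@imem Q Rep (phi j)) (@imem Q Rep (psi j))).
    apply: matched_trans (matched_sym (iidx_bullet t')) _.
    by rewrite E'; apply: same_family_matched (sf j).
  have [g [f [gf fg F]]] := matched_fun mt.
  (* Both parts embed into the type of [x], hence are finite. *)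
  have [p hp] : exists p, bullet p = phi j.
    apply: (bullet_ex (f := f \o inl)) => [a b /(can_inj fg) [] //|a].
    by rewrite /= -F fg.
  have [q hq] : exists q, bullet q = psi j.
    apply: (bullet_ex (f := f \o inr)) => [a b /(can_inj fg) [] //|a].
    by rewrite /= -F fg.
  apply: (@q_contr _ _ x y z M p q).
  + by rewrite (dagger_names hd).
  + apply: matched_same_family; apply: matched_sym.
    have := matched_trans mt (matched_join (l := @imem Q Rep (phi j)) (m := @imem Q Rep (psi j)) _ _).
    rewrite -hp -hq => /(_ _ _ _ _ (iidx_bullet p) (iidx_bullet q)) /matched_sym.
    case/matched_fun=> f' [g' [fg' gf' F']]; apply: (@matched_bij _ _ _ _ _ f' g') => // c.
    by apply: bullet_inj; rewrite F'; case: c.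
  + apply: (IH j) => //.
    by apply: dagger_cons; rewrite //= ?kind_of_restrict //; apply: dagger_cons; rewrite //= kind_of_restrict.
- move=> J K u v A G x M sg phi s tau B uv vu br h IH k Gq t.
  case/dagger_cons_inv=> t' [Gq' [/= E' -> hd]] ht.
  (* Since [u] is bijective, the fiber over [k] is the point [v k], and the compound type has one
     member. *)
  have [e [e1 e2 e3 e4]] := bracket_at br E'.
  have [a ea] := e3 (v k) (vu k).
  apply: (@q_left_inter _ _ _ (@qmem Q Rep t' a)).
    exists (fun _ => tt); last first.
      by move=> b /=; congr qmem; apply: e1; rewrite ea -(e2 b) uv.
    by exists (fun _ => a) => [b|[]] //; apply: e1; rewrite ea -(e2 b) uv.
  rewrite -(kind_of_reindex v B); apply: (IH (v k)); last by rewrite vu.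
  by apply: dagger_cons => //; [rewrite e4 ea|apply: dagger_reindex].
- move=> J L v G G0 M tau psi B f2 br h IH l Gq t hd E.
  have [js [j1 j2 j3 j4]] := bracket_at br E.
  have [Gs hGs hds] := promote_inter j1 j2 j3 f2 hd.
  dependent destruction t => /=.
  apply: q_right_inter hGs _ _; first by rewrite (dagger_erase hd); apply: ilc_simply_typed (i_prom f2 br h).
  by move=> a; apply: (IH (js a)).
Qed.

(** * From intersection types to ILC *)

(** Families over a singleton are constant, so only the choice of the formula is left open. *)
Inductive fits (Q : finType) (J : countType) : ientry Q J -> qentry Q -> Prop :=
  | Fits x s (t : qtype Q s) (A : formula J s) :
      refines A (fun _ => bullet t) ->
      fits (IEntry x (fun _ => bullet t) A) (QEntry x t (kind_of A)).

Lemma fits_inv (Q : finType) (J : countType) (e : ientry Q J) qe :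
  fits e qe -> exists A, [/\ e = IEntry (qname qe) (fun _ => bullet (qty qe)) A,
    refines A (fun _ => bullet (qty qe)) & kind_of A = qkind qe].
Proof. by case=> x s t A h; exists A. Qed.

Lemma fits_cons (Q : finType) (J : countType) x s (t : qtype Q s) (A : formula J s) k D G :
  refines A (fun _ => bullet t) -> kind_of A = k -> Forall2 (@fits Q J) D G ->
  Forall2 (@fits Q J) (IEntry x (fun _ => bullet t) A :: D) (QEntry x t k :: G).
Proof. by move=> h <- hD; constructor. Qed.

Lemma fits_cons_inv (Q : finType) (J : countType) x s (t : qtype Q s) k D G :
  Forall2 (@fits Q J) D (QEntry x t k :: G) ->
  exists A D', [/\ D = IEntry x (fun _ => bullet t) A :: D',
    refines A (fun _ => bullet t), kind_of A = k & Forall2 (@fits Q J) D' G].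
Proof.
move=> h; inversion_clear h as [|e qe D' G' h1 h2].
by have [A [-> hA kA]] := fits_inv h1; exists A, D'.
Qed.

Lemma fits_names (Q : finType) (J : countType) (D : ictx Q J) G :
  Forall2 (@fits Q J) D G -> inames D = qnames G.
Proof. by elim=> //= e qe D' G' /fits_inv[A [-> _ _]] _ /= ->. Qed.

Lemma fits_reindex (Q : finType) (J K : countType) (u : J -> K) (v : K -> J) (D : ictx Q K) G :
  cancel u v -> cancel v u -> Forall2 (@fits Q K) D G -> Forall2 (@fits Q J) (ireindex u v D) G.
Proof.
move=> uv vu; elim=> [|e qe D' G' /fits_inv[A [-> hA kA]] _ IH]; first by constructor.
case: qe A hA kA => x s t k A /= hA <-; apply: fits_cons => //.
  exact: (refines_reindex uv vu hA).
exact: kind_of_reindex.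
Qed.

(** An intersection of contexts has only intersections as entries, so every formula is a [Bang] and
    the context can be read as a function on resources. *)
Lemma fits_realizes (Q : finType) (X J : countType) (j0 : J) (Gs : X -> qctx Q) G D :
  (forall j, j = j0) -> qctx_inter Gs G -> Forall2 (@fits Q J) D G ->
  exists (G' : seq (bent Q)) (u : bres G' -> J),
    [/\ realizes u D, matched (lab (@qlab Q) (s := G)) (lab (@blab Q) (s := G')),
        bnames G' = qnames G
      & forall v k, list_env (qerase G) v k -> benv G' v k].
Proof.
move=> hJ hG; elim: hG D => {Gs G} [|Gs G x k s tau phi _ _ IH] D.
  move=> h; inversion_clear h; exists [::], (fun h : Empty_set => match h with end); split=> //.
  - exact: matched_refl.
  - by move=> v k [].
case/fits_cons_inv=> R [D' [-> hR kR /IH[G' [u [h1 h2 h3 h4]]]]].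
have [I [w [B E]]] := bang_inv R; subst R.
have [tau1 hB br] := refines_bang_bullet (phi := fun _ => phi) hR.
have [e [e1 e2 e3 e4]] := (bracket_bulletP _ _ _).1 br j0.
exists (Bent x hB :: G'), (fun h => match h with inl i => w i | inr h => u h end); split.
- by exists (fun _ => bullet phi), D'.
- rewrite !lab_cons; apply: matched_join h2.
  exists (fun a i => e a = i); last by move=> a i <-; rewrite /qlab /= e4.
  split=> [a|i|a b i <- /e1|a i i' <- <-] //; first by split=> // _; exists (e a).
  by split=> // _; apply: e3.
- by rewrite /= h3.
- move=> v l [y -> /= [[<- <-]|h]]; first by left.
  by right; apply: h4; exists y.
Qed.

(** The induction ranges over every singleton index set, not only [unit], because dereliction
    replaces [J] by the domain of the formula. *)
Lemma quant_ilc (Q : finType) (G : qctx Q) M s (t : qtype Q s) k :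
  quant G M t k ->
  forall (J : countType) (j0 : J) (D : ictx Q J) (A : formula J s),
  (forall j, j = j0) -> Forall2 (@fits Q J) D G -> refines A (fun _ => bullet t) ->
  kind_of A = k -> ilc D M (fun _ => bullet t) A.
Proof.
elim=> {G M s t k}.
- move=> x q J j0 D A _ /fits_cons_inv[A' [D' [-> _ /kind_base -> h]]] _ /kind_base ->.
  by inversion_clear h; apply: (i_ax x (fun _ => q)).
- move=> G G' M s t k p _ IH J j0 D A hJ /Forall2_flip hD hA kA.
  have [D' [p' /Forall2_flip hD']] := Permutation_Forall2 (Permutation_sym p) hD.
  by apply: i_exchange (Permutation_sym p') _; apply: (IH _ j0).
- move=> G x tau phi k M s t k' sf hM IH J j0 D A hJ.
  case/fits_cons_inv=> R [D' [-> hR kR hD]] hA kA.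
  have [I [u [B E]]] := bang_inv R; subst R.
  have [tau1 hB br] := refines_bang_bullet (phi := fun _ => phi) hR.
  have [e [e1 e2 e3 e4]] := (bracket_bulletP _ _ _).1 br j0.
  have [f [g fg gf] ef] := sf.
  (* One member over a one-point [J] leaves a single point in [I], so [u] is a bijection. *)
  have hI i : i = e (g tt).
    by have [a <-] := e3 i (hJ _); congr e; rewrite -[a]fg; case: (f a).
  have uv : cancel u (fun _ => e (g tt)) by move=> i; exact: esym (hI i).
  have vu : cancel (fun _ => e (g tt)) u by move=> j; rewrite e2 (hJ j).
  have Etau : tau1 = fun _ => tau.
    by apply: functional_extensionality => i; rewrite [i]hI -e4 ef.
  subst tau1; apply: (i_der uv vu br).
  apply: (IH I (e (g tt))) => //.
  + by apply: fits_cons => //; apply: fits_reindex.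
  + exact: (refines_reindex uv vu hA).
  + by rewrite kind_of_reindex.
- move=> X fX Gs G M tau k hG st hM _ J j0 D A hJ hD hA kA.
  have [I [v [B E]]] := bang_inv A; subst A.
  have [tau1 hB br] := refines_bang_bullet (phi := fun _ => QInter fX tau) hA.
  have [e [e1 e2 e3 e4]] := (bracket_bulletP _ _ _).1 br j0.
  have [G' [u [h1 h2 h3 h4]]] := fits_realizes hJ hG hD.
  have [f [g [fg gf F]]] := matched_fun (matched_trans (matched_inter hG) h2).
  (* [tag (g h)] is the copy of [M] that consumes [h]. As [J] is a singleton, two functions into it
     agree, which gives the factorization through [v]. *)
  have Eu : u = v \o (fun h => e (tag (g h))).
    by apply: functional_extensionality => h; rewrite /= [RHS]hJ; apply: hJ.
  move: h1; rewrite Eu => /realizes_promote[D0 hD0 prom].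
  apply: (i_prom prom br); apply: (family_ilc hD0) => //.
  + by rewrite h3; have := simply_typed_uniq st; rewrite /qerase -map_comp.
  + rewrite [kind_of B]kA -(rn_id M); apply: styp_rn (simply_typed_styp st) => w l; exact: h4.
  + move=> i; have [a <-] := e3 i (hJ _); rewrite -e4 /=.
    have /typed_lin := quant_typed (hM a).
    apply: (uses_rel (R := fun h h' => f (existT _ a h) = h')).
      split=> [h|h'|b c h' <- /(can_inj fg) E|b c c' <- <-] //.
      * by split=> // _; exists (f (existT _ a h)).
      * split=> [/e1 E|[h <-]]; last by rewrite fg.
        rewrite -(gf h'); move: E; case: (g h') => a' h /= E; subst a'.
        by exists h.
      * by symmetry; apply: Eqdep.EqdepTheory.inj_pair2 E.
    by move=> h _ <-; rewrite F.
- move=> G1 G2 f x N M phi sg s al k k' k'' un hN IHN hM IHM J j0 D A hJ.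
  case/fits_cons_inv=> R [D' [-> hR kR hD]] hA kA.
  have [Da [Db [ha [hb E]]]] := Forall2_app_inv_r _ _ hD; subst D'.
  have [I [w [B [C [E kB kC]]]]] := kind_arr kR; subst R.
  have [phi' [tau' [E hB hC]]] := refines_lolli_bullet (sg := fun _ => QArr phi sg) hR.
  have Ep : phi' = fun _ => phi.
    by apply: functional_extensionality => j; have := equal_f E j => -[].
  have Et : tau' = fun _ => sg.
    by apply: functional_extensionality => j; have := equal_f E j => -[].
  subst phi' tau'; apply: (i_left (phi := fun _ => bullet phi) (sigma := fun _ => bullet sg)).
  + by rewrite (fits_names hD).
  + exact: (IHN _ j0).
  + by apply: (IHM _ j0) => //; apply: fits_cons.
- move=> G x M phi sg k k' hM IH J j0 D A hJ hD hA kA.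
  have [I [w [B [C [E kB kC]]]]] := kind_arr kA; subst A.
  have [phi' [tau' [E hB hC]]] := refines_lolli_bullet (sg := fun _ => QArr phi sg) hA.
  have Ep : phi' = fun _ => phi.
    by apply: functional_extensionality => j; have := equal_f E j => -[].
  have Et : tau' = fun _ => sg.
    by apply: functional_extensionality => j; have := equal_f E j => -[].
  subst phi' tau'; apply: (i_right (phi := fun _ => bullet phi) (sigma := fun _ => bullet sg)).
  by apply: (IH _ j0) => //; apply: fits_cons.
- move=> G x M phi s t k k' xG em hM IH J j0 D A hJ.
  case/fits_cons_inv=> R [D' [-> hR kR hD]] hA kA.
  have [I [u [B E]]] := bang_inv R; subst R.
  have [tau1 hB br] := refines_bang_bullet (phi := fun _ => phi) hR.
  have [e [e1 e2 e3 e4]] := (bracket_bulletP _ _ _).1 br j0.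
  apply: i_weak.
  + by rewrite (fits_names hD).
  + by move=> i; have [a _] := e3 i (hJ _).
  + by move=> _ a; have [f _] := matched_fun (iidx_bullet phi); apply: em (f a).
  + exact: (IH _ j0).
- move=> G x y z M phi psi chi s t k k' xG sf hM IH J j0 D A hJ.
  case/fits_cons_inv=> R [D' [-> hR kR hD]] hA kA.
  have [I [u [B E]]] := bang_inv R; subst R.
  have [tau1 hB br] := refines_bang_bullet (phi := fun _ => chi) hR.
  have [e [e1 e2 e3 e4]] := (bracket_bulletP _ _ _).1 br j0.
  have [f [g fg gf] ef] := sf.
  have /choice[e' he'] i : exists a, e a = i by apply: e3; apply: hJ.
  have e'e a : e' (e a) = a by apply: e1; rewrite he'.
  (* The domain is cut according to the summand, [phi] or [psi], from which the member of [chi] at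
     this index comes. *)
  pose P i := if f (e' i) is inl _ then true else false.
  have Pl a : P (e (g (inl a))) by rewrite /P e'e gf.
  have Pr a : ~~ P (e (g (inr a))) by rewrite /P e'e gf.
  have brl : is_bracket (fun i : {i | P i} => u (sval i)) (fun i => bullet (tau1 (sval i)))
      (fun _ => bullet phi).
    apply/(bracket_bulletP _ (fun i : {i | P i} => tau1 (sval i)) (fun _ => phi)) => j.
    exists (fun a => exist _ (e (g (inl a))) (Pl a)); split.
    + by move=> a b [/e1/(can_inj gf)[]].
    + by move=> a; rewrite [RHS]hJ; apply: hJ.
    + move=> [i Pi] _; have [a Ef] : exists a, f (e' i) = inl a.
        by move: (Pi); rewrite /P; case: (f _) => // a _; exists a.
      by exists a; apply: val_inj; rewrite /= -Ef fg he'.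
    + by move=> a /=; rewrite -e4 ef /= gf.
  have brr : is_bracket (fun i : {i | ~~ P i} => u (sval i)) (fun i => bullet (tau1 (sval i)))
      (fun _ => bullet psi).
    apply/(bracket_bulletP _ (fun i : {i | ~~ P i} => tau1 (sval i)) (fun _ => psi)) => j.
    exists (fun a => exist _ (e (g (inr a))) (Pr a)); split.
    + by move=> a b [/e1/(can_inj gf)[]].
    + by move=> a; rewrite [RHS]hJ; apply: hJ.
    + move=> [i Pi] _; have [a Ef] : exists a, f (e' i) = inr a.
        by move: (Pi); rewrite /P; case: (f _) => // a _; exists a.
      by exists a; apply: val_inj; rewrite /= -Ef fg he'.
    + by move=> a /=; rewrite -e4 ef /= gf.
  apply: (i_contr _ (bracket_contr br brl brr)); first by rewrite (fits_names hD).
  apply: (IH _ j0) => //; apply: fits_cons; rewrite /= ?kind_of_restrict //.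
    exact: (refines_bang (refines_restrict P hB) brl).
  apply: fits_cons; rewrite /= ?kind_of_restrict //.
  exact: (refines_bang (refines_restrict (fun i => ~~ P i) hB) brr).
Qed.

(** The induction is on the kind, not on a type, since one formula has to fit all types of the
    family at once. *)
Lemma kinding_formula (Q : finType) k (J : countType) s (t : J -> qtype Q s) :
  (forall j, kinding (t j) k) ->
  exists A : formula J s, kind_of A = k /\ refines A (fun j => bullet (t j)).
Proof.
(* A family of intersections is refined by the [Bang] of the projection from the set of all its
   members. *)
have rep k' : (forall (I : countType) (tau : I -> qtype Q Lin), (forall i, kinding (tau i) k') ->
      exists A, kind_of A = k' /\ refines A (fun i => bullet (tau i))) ->
    forall (K : countType) (phi : K -> qtype Q Rep), (forall j, kinding (phi j) k') ->
      exists A, kind_of A = k' /\ refines A (fun j => bullet (phi j)).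
  move=> lin K phi hk.
  have [|A [kA hA]] := lin {j : K & qidx (phi j)} (fun p => @qmem Q Rep (phi (tag p)) (tagged p)).
    by move=> [j a]; move/kinding_qmem: (hk j).
  exists (Bang (fun p => tag p) A); split=> //; apply: (refines_bang hA).
  apply/bracket_bulletP => j; exists (fun a => existT _ j a); split=> //.
  - by move=> a b E; apply: Eqdep.EqdepTheory.inj_pair2 E.
  - by move=> [j' a] /= E; subst j'; exists a.
elim: k J s t => [|k1 IH1 k2 IH2] J s t; last first.
  have lin : forall (I : countType) (tau : I -> qtype Q Lin), (forall i, kinding (tau i) (KArr k1 k2)) ->
      exists A, kind_of A = KArr k1 k2 /\ refines A (fun i => bullet (tau i)).
    move=> I tau hk.
    have /choice[f hf] i : exists p : qtype Q Rep * qtype Q Lin,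
        [/\ tau i = QArr p.1 p.2, kinding p.1 k1 & kinding p.2 k2].
      have := hk i; move: (tau i) => r hr; dependent destruction hr.
      by exists (phi, sigma).
    have [|A1 [kA1 hA1]] := IH1 I Rep (fun i => (f i).1); first by move=> i; case: (hf i).
    have [|A2 [kA2 hA2]] := IH2 I Lin (fun i => (f i).2); first by move=> i; case: (hf i).
    exists (Lolli A1 A2); rewrite /= kA1 kA2; split=> //.
    have -> : (fun i => bullet (tau i)) = (fun i => ILolli (bullet (f i).1) (bullet (f i).2)).
      by apply: functional_extensionality => i; case: (hf i) => ->.
    exact: refines_lolli.
  by case: s t; [apply: lin|apply: rep].
have lin : forall (I : countType) (tau : I -> qtype Q Lin), (forall i, kinding (tau i) KBase) ->
      exists A, kind_of A = KBase /\ refines A (fun i => bullet (tau i)).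
  move=> I tau hk.
  have /choice[f hf] i : exists q, tau i = QState q.
    by have := hk i; move: (tau i) => r hr; dependent destruction hr; exists q.
  exists Bot; split=> //.
  have -> : (fun i => bullet (tau i)) = (fun i => IState (f i)).
    by apply: functional_extensionality => i; rewrite hf.
  exact: refines_bot.
by case: s t; [apply: lin|apply: rep].
Qed.

Theorem theorem2 (Q : finType) :
  (forall (I : countType) (i : I), (forall j : I, j = i) ->
     forall (G : ictx Q I) (M : term) (s : flavor) (sigma : I -> itype Q s)
            (A : formula I s),
       ilc G M sigma A ->
       forall (G' : qctx Q) (sigma' : qtype Q s),
         dagger i G G' -> circ (sigma i) sigma' ->
         quant G' M sigma' (kind_of A))
  /\
  (forall (G : qctx Q) (M : term) (s : flavor) (sigma : qtype Q s) (k : kind),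
     quant G M sigma k ->
     exists (G' : ictx Q unit) (A : formula unit s),
       dagger tt G' G /\ ilc G' M (fun _ : unit => bullet sigma) A).
Proof.
split=> [I i _ G M s sigma A h G' sigma' hd|G M s sigma k h].
  exact: (ilc_quant h hd).
(* Derivable sequents are kinded, which yields a formula for each of their types. *)
have [kG kt] := quant_kinded h.
have [A [kA hA]] := kinding_formula (fun _ : unit => kt).
have [D hD] : exists D : ictx Q unit, Forall2 (@fits Q unit) D G.
  elim: kG => [|[x s' t l] G' /= kt' _ [D hD]]; first by exists [::]; constructor.
  have [A' [kA' hA']] := kinding_formula (fun _ : unit => kt').
  by eexists; apply: fits_cons hA' kA' hD.
exists D, A; split; last by apply: (quant_ilc h (j0 := tt)) => // -[].
elim: hD => [|_ _ D' G' [x s' t B _] _ IH]; first by constructor.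
by constructor.
Qed.
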